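(* Let $G=(V,D,B)$ be a mixed graph such that every family $(Y_v : v\in V)$ of subsets of $V$ either contains a set $Y_v$ that does not satisfy the half-trek criterion with respect to $v$, or contains a pair $Y_v,Y_w$ with $v\in Y_w$ and $w\in Y_v$. Then $\phi_G$ is generically infinite-to-one.
   Context: A mixed graph is a triple $G=(V,D,B)$ with $V=[m]$, $D\subseteq V\times V$ a set of directed edges $v\to w$, and $B$ a symmetric set of bidirected edges $v\leftrightarrow w$; no self-loops. $\mathrm{pa}(v)=\{w: w\to v\in D\}$, $\mathrm{sib}(v)=\{w : w\leftrightarrow v\in B\}$. $\mathbb{R}^D_{\mathrm{reg}}$ is the set of real $m\times m$ matrices $\Lambda$ with $\lambda_{vw}=0$ whenever $v\to w\notin D$ and $I-\Lambda$ invertible; $\mathrm{PD}(B)$ the positive definite symmetric $\Omega$ with $\omega_{vw}=0$ whenever $v\ne w$, $v\leftrightarrow w\notin B$; $\Theta=\mathbb{R}^D_{\mathrm{reg}}\times\mathrm{PD}(B)$; $\phi_G(\Lambda,\Omega)=(I-\Lambda)^{-T}\Omega(I-\Lambda)^{-1}$. A proper algebraic subset of $\Theta$ is the zero set in $\Theta$ of some polynomials in the entries of $(\Lambda,\Omega)$, not equal to $\Theta$. $\phi_G$ is generically infinite-to-one if the fiber $\{(\Lambda',\Omega')\in\Theta:\phi_G(\Lambda',\Omega')=\phi_G(\Lambda,\Omega)\}$ is infinite for all $(\Lambda,\Omega)$ outside a proper algebraic subset of $\Theta$. Treks: a path is a sequence of edges of $D\cup B$ connecting consecutive nodes (not necessarily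 simple, directed edges traversable either way). A half-trek from $v$ to $w$ is a path of the form $v\leftrightarrow w_0\to w_1\to\cdots\to w_r=w$ (left side $\{v\}$, right side $\{w_0,\dots,w_r\}$) or $v\to w_1\to\cdots\to w_r=w$ with $r\ge0$ (left side $\{v\}$, right side $\{v,w_1,\dots,w_r\}$). A system of half-treks from $X$ to $Y$ is a set of $|X|=|Y|$ half-treks whose sources are exactly the distinct elements of $X$ and targets exactly the distinct elements of $Y$; it has no sided intersection if the left sides are pairwise disjoint and the right sides are pairwise disjoint. A set $Y\subseteq V$ satisfies the half-trek criterion with respect to $v$ if (i) $|Y|=|\mathrm{pa}(v)|$, (ii) $Y\cap(\{v\}\cup\mathrm{sib}(v))=\emptyset$, (iii) there is a system of half-treks with no sided intersection from $Y$ to $\mathrm{pa}(v)$. *)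

(* Defs.v *)
From Stdlib Require Import Reals.
From mathcomp Require Import all_boot.

Set Implicit Arguments.
Unset Strict Implicit.
Unset Printing Implicit Defensive.

(* D u w  means  u -> w  is a directed edge;  B u w  means  u <-> w.   *)
Definition mixed_graph (m : nat) (D B : rel 'I_m) : Prop :=
  (forall v, ~~ D v v) /\ (forall v, ~~ B v v) /\ (forall v w, B v w = B w v).

Definition pa (m : nat) (D : rel 'I_m) (v : 'I_m) : {set 'I_m} := [set w | D w v].
Definition sib (m : nat) (B : rel 'I_m) (v : 'I_m) : {set 'I_m} := [set w | B w v].

(* A half-trek starting at v is encoded by (b, ws):
   - b = true , ws = [:: w0; w1; ...; wr] : the path v <-> w0 -> w1 -> ... -> wr,
       right side {w0,...,wr};
   - b = false, ws = [:: w1; ...; wr] (r >= 0) : the path v -> w1 -> ... -> wr,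
       right side {v, w1, ..., wr}.
   In both cases the left side is {v} and the target is  last v ws. *)
Definition is_half_trek (m : nat) (D B : rel 'I_m) (v : 'I_m)
    (h : bool * seq 'I_m) : bool :=
  if h.1 then
    match h.2 with
    | w0 :: rest => B v w0 && path D w0 rest
    | [::] => false
    end
  else path D v h.2.

Definition ht_target (m : nat) (v : 'I_m) (h : bool * seq 'I_m) : 'I_m :=
  last v h.2.

Definition ht_left (m : nat) (v : 'I_m) (h : bool * seq 'I_m) : seq 'I_m :=
  [:: v].

Definition ht_right (m : nat) (v : 'I_m) (h : bool * seq 'I_m) : seq 'I_m :=
  if h.1 then h.2 else v :: h.2.

Definition system_no_sided_intersection (m : nat) (D B : rel 'I_m)
    (X Y : {set 'I_m}) : Prop :=
  #|X| = #|Y| /\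
  exists (tgt : 'I_m -> 'I_m) (pth : 'I_m -> bool * seq 'I_m),
    (forall x, x \in X -> is_half_trek D B x (pth x) /\ ht_target x (pth x) = tgt x)
    /\ {in X &, injective tgt}
    /\ tgt @: X = Y
    /\ (forall x x', x \in X -> x' \in X -> x != x' ->
          [disjoint ht_left x (pth x) & ht_left x' (pth x')])
    /\ (forall x x', x \in X -> x' \in X -> x != x' ->
          [disjoint ht_right x (pth x) & ht_right x' (pth x')]).

Definition HTC (m : nat) (D B : rel 'I_m) (Y : {set 'I_m}) (v : 'I_m) : Prop :=
  #|Y| = #|pa D v| /\
  Y :&: (v |: sib B v) = set0 /\
  system_no_sided_intersection D B Y (pa D v).

Definition mx (m : nat) := 'I_m -> 'I_m -> R.

Definition mx_mul (m : nat) (A C : mx m) : mx m :=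
  fun i j => \big[Rplus/R0]_(k < m) (Rmult (A i k) (C k j)).

Definition mx_id (m : nat) : mx m := fun i j => if i == j then R1 else R0.

Arguments mx_id : clear implicits.

Definition mx_sub (m : nat) (A C : mx m) : mx m := fun i j => (Rminus (A i j) (C i j)).

Definition mx_tr (m : nat) (A : mx m) : mx m := fun i j => A j i.

Definition is_inverse (m : nat) (A N : mx m) : Prop :=
  mx_mul A N = mx_id m /\ mx_mul N A = mx_id m.

Definition invertible (m : nat) (A : mx m) : Prop := exists N, is_inverse A N.

Definition in_RDreg (m : nat) (D : rel 'I_m) (L : mx m) : Prop :=
  (forall v w, ~~ D v w -> L v w = R0) /\ invertible (mx_sub (mx_id m) L).

Definition in_PDB (m : nat) (B : rel 'I_m) (O : mx m) : Prop :=
  (forall v w, O v w = O w v) /\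
  (forall v w, v != w -> ~~ B v w -> O v w = R0) /\
  (forall x : 'I_m -> R, (exists i, x i <> R0) ->
     Rlt R0 (\big[Rplus/R0]_(i < m) \big[Rplus/R0]_(j < m) Rmult (Rmult (x i) (O i j)) (x j))).

Definition Theta (m : nat) (D B : rel 'I_m) (p : mx m * mx m) : Prop :=
  in_RDreg D p.1 /\ in_PDB B p.2.

Definition phi_rel (m : nat) (p : mx m * mx m) (S : mx m) : Prop :=
  exists N, is_inverse (mx_sub (mx_id m) p.1) N /\
            S = mx_mul (mx_tr N) (mx_mul p.2 N).

Definition fiber (m : nat) (D B : rel 'I_m) (p : mx m * mx m)
    (q : mx m * mx m) : Prop :=
  Theta D B q /\ exists S, phi_rel p S /\ phi_rel q S.

Definition infinite_set (T : Type) (S : T -> Prop) : Prop :=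
  forall l : list T, exists x, S x /\ ~ List.In x l.

Inductive rpoly (X : Type) : Type :=
  | PConst : R -> rpoly X
  | PVar : X -> rpoly X
  | PAdd : rpoly X -> rpoly X -> rpoly X
  | PMul : rpoly X -> rpoly X -> rpoly X.

Fixpoint peval (X : Type) (env : X -> R) (p : rpoly X) : R :=
  match p with
  | PConst c => c
  | PVar x => env x
  | PAdd p q => Rplus (peval env p) (peval env q)
  | PMul p q => Rmult (peval env p) (peval env q)
  end.

Definition param_var (m : nat) := (bool * ('I_m * 'I_m))%type.

Definition param_env (m : nat) (p : mx m * mx m) : param_var m -> R :=
  fun x => if x.1 then p.2 x.2.1 x.2.2 else p.1 x.2.1 x.2.2.

Definition proper_algebraic_subset (m : nat) (D B : rel 'I_m)
    (A : mx m * mx m -> Prop) : Prop :=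
  (exists ps : list (rpoly (param_var m)),
     forall p, A p <-> (Theta D B p /\
                        forall f, List.In f ps -> peval (param_env p) f = R0))
  /\ exists p, Theta D B p /\ ~ A p.

Definition generically_infinite_to_one (m : nat) (D B : rel 'I_m) : Prop :=
  exists A, proper_algebraic_subset D B A /\
    forall p, Theta D B p -> ~ A p -> infinite_set (fiber D B p).

(* Main.v *)
Require Import Defs.
From Stdlib Require Import Reals.
From mathcomp Require Import boolp classical_sets reals topology normedtype.
From mathcomp Require Import Rstruct.
From mathcomp Require Import all_boot all_order all_fingroup all_algebra.
From mathcomp Require Import zify ring lra.

(** Fix [S = phi(L, O)] and put [A = I - L]. The fiber through [(L, O)] is cut
    out by the equations [(A^T S A) v w = 0] for [v], [w] not adjacent in [B];
    the Jacobian of these equations has the matrices [O A^-1] as building blocks.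

    If this Jacobian had full column rank at some point, then [|D|] of its rows
    would form a nonsingular matrix [C (A (x) I)^-1 E]. By Schur complements the
    block matrix [A (x) I, E; C, 0] is nonsingular too, so some permutation
    meets only nonzero entries of it. Following the permutation from a row of
    [C] until its first arrival in a column of [E] traces a half-trek; distinct
    half-treks are disjoint because the permutation is injective. Each chosen
    row is a nonadjacent pair and serves exactly one endpoint, so the resulting
    family satisfies the half-trek criterion and has no pair with [v] in [Y w]
    and [w] in [Y v].

    Hence the Jacobian never has full column rank, and Cramer's rule gives a
    polynomial vector field in the kernel of the differential of [phi] that is
    nonzero wherever one fixed minor of maximal order is. Euler polygons of this
    field move a coordinate by a prescribed amount and change [phi] by an amount
    that tends to 0 with the step size; a cluster point of their endpoints lies
    in the fiber. *)

Set Implicit Arguments.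
Unset Strict Implicit.
Unset Printing Implicit Defensive.

Import Order.TTheory GRing.Theory Num.Theory.
(* Arguments of type [R] would otherwise be parsed in [R_scope]. *)
Bind Scope ring_scope with R.
Local Open Scope ring_scope.

(** * From a nonsingular minor to half-treks *)

Lemma iter_inj (T : Type) (s : T -> T) (n : nat) :
  injective s -> injective (iter n s).
Proof. by move=> s_inj; elim: n => // n IH x y /s_inj/IH. Qed.

(** On a finite type an injective map moves every point along a cycle, so some positive iterate
    comes back to [P]; [k] picks the least one. *)
Lemma first_return (T : finType) (s : T -> T) (P : pred T) : injective s ->
  exists k : T -> nat, forall x, P x ->
    [/\ (0 < k x)%N, P (iter (k x) s x)
      & forall t, (0 < t < k x)%N -> ~~ P (iter t s x)].
Proof.
move=> s_inj.
have ex x : exists t, P x ==> ((0 < t)%N && P (iter t s x)).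
  by exists (fingraph.order s x);
    rewrite fingraph.iter_order // fingraph.order_gt0 /= implybb.
exists (fun x => ex_minn (ex x)) => x Px; case: ex_minnP => k.
rewrite Px /= => /andP[k_gt0 Pk] kmin; split=> // t /andP[t_gt0 tk].
by apply: contraL tk => Pt; rewrite -leqNgt kmin // t_gt0.
Qed.

(** Cancelling the smaller number of iterations writes one starting point as an iterate of the
    other. If the two numbers differ, this is a visit to [P] before the first return. *)
Lemma first_return_disjoint (T : finType) (s : T -> T) (P : pred T)
    (k : T -> nat) (x y : T) (a b : nat) : injective s ->
  (forall z, P z -> forall t, (0 < t < k z)%N -> ~~ P (iter t s z)) ->
  P x -> P y -> (0 < a <= k x)%N -> (0 < b <= k y)%N ->
  iter a s x = iter b s y -> x = y.
Proof.
move=> s_inj Pk; wlog le_ab : x y a b / (a <= b)%N => [IH | ] Px Py ak bk eab.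
  case/orP: (leq_total a b) => leab; first exact: IH leab Px Py ak bk eab.
  exact/esym/(IH _ _ _ _ leab Py Px bk ak)/esym.
have ex : x = iter (b - a) s y.
  by apply: (@iter_inj _ s a s_inj); rewrite -iterD subnKC.
have [ba0|ba_gt0] := posnP (b - a); first by rewrite ex ba0.
have := Pk y Py (b - a)%N; rewrite -ex Px.
by move=> /(_ ltac:(lia)).
Qed.

Lemma path_map_iota (T : Type) (e : rel T) (g : nat -> T) (a n : nat) :
  (forall t, (a <= t < a + n)%N -> e (g t) (g t.+1)) ->
  path e (g a) (map g (iota a.+1 n)).
Proof.
elim: n a => //= n IH a H; rewrite H /=; last by lia.
by apply: IH => t t_lt; apply: H; lia.
Qed.

Lemma last_map_iota (T : Type) (g : nat -> T) (a n : nat) :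
  last (g a) (map g (iota a.+1 n)) = g (a + n)%N.
Proof. by elim: n a => [|n IH] a /=; rewrite ?addn0 // IH addSnnS. Qed.

Lemma det_neq0_perm (R : comPzRingType) (n : nat) (A : 'M[R]_n) : \det A != 0 ->
  exists s : 'S_n, forall i, A i (s i) != 0.
Proof.
move=> detA; suff /existsP[s /forallP sA] :
    [exists s : 'S_n, forall i, A i (s i) != 0] by exists s.
apply: contraNT detA => /existsPn nex; rewrite /determinant big1 // => s _.
have /forallPn[i] := nex s; rewrite negbK => /eqP Ai0.
by rewrite (bigD1 i) //= Ai0 mul0r mulr0.
Qed.

(** Block elimination: the lower right block becomes the Schur complement [- C A^-1 E]. *)
Lemma unitmx_schur (F : fieldType) (p n : nat) (A : 'M[F]_p)
    (E : 'M_(p, n)) (C : 'M_(n, p)) :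
  A \in unitmx -> C *m invmx A *m E \in unitmx ->
  block_mx A E C 0 \in unitmx.
Proof.
move=> Au Ku.
have -> : block_mx A E C 0 =
    block_mx 1%:M 0 (C *m invmx A) 1%:M
      *m block_mx A E 0 (- (C *m invmx A *m E)).
  rewrite mulmx_block !mul1mx !mul0mx !addr0 -[C *m _ *m A]mulmxA mulVmx //.
  by rewrite mulmx1 addrN.
rewrite unitmx_mul !unitmxE det_lblock det_ublock !det1 mulr1 unitr1 /=.
by rewrite unitrM -!unitmxE Au -scaleN1r unitmxZ ?unitrN1.
Qed.

(** * The Jacobian of the fiber equations and its factorization *)

Section JacobianMatrix.
Variables (F : fieldType) (m : nat) (D B : rel 'I_m).

Definition edges : {set 'I_m * 'I_m} := [set e | D e.1 e.2].

(** Each unordered pair is listed once, smaller vertex first, since the equations come from a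
    symmetric matrix. *)
Definition nonadj : {set 'I_m * 'I_m} :=
  [set e : 'I_m * 'I_m | (e.1 < e.2)%N && ~~ B e.1 e.2].

(** The Jacobian before its columns are restricted to [edges]: a row [(v, w)] carries row [w] of [M]
    in copy [v] and row [v] of [M] in copy [w]. *)
Definition rows_mx (M : 'M[F]_m) : 'M_(#|nonadj|, #|{: 'I_m * 'I_m}|) :=
  \matrix_(i, b)
    (M (enum_val i).2 (enum_val b).1 *+ ((enum_val b).2 == (enum_val i).1)
     + M (enum_val i).1 (enum_val b).1 *+ ((enum_val b).2 == (enum_val i).2)).

(* One copy of [A] for each possible head [v] of an edge [u -> v]. *)
Definition copies_mx (A : 'M[F]_m) : 'M_(#|{: 'I_m * 'I_m}|) :=
  \matrix_(a, b)
    (A (enum_val a).1 (enum_val b).1 *+ ((enum_val a).2 == (enum_val b).2)).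

Definition edges_mx : 'M[F]_(#|{: 'I_m * 'I_m}|, #|edges|) :=
  \matrix_(a, j) (enum_val a == enum_val j)%:R.

(* For [M = (I - L)^T S], this is up to sign the Jacobian with respect to the
   entries of [L] on [edges] of the entries of [(I - L)^T S (I - L)] on
   [nonadj]. *)
Definition jacobian (M : 'M[F]_m) : 'M_(#|nonadj|, #|edges|) :=
  \matrix_(i, j)
    (M (enum_val i).2 (enum_val j).1 *+ ((enum_val j).2 == (enum_val i).1)
     + M (enum_val i).1 (enum_val j).1 *+ ((enum_val j).2 == (enum_val i).2)).

Lemma sum_enum_val (T : finType) (V : nmodType) (f : T -> V) :
  \sum_(a < #|T|) f (enum_val a) = \sum_x f x.
Proof. by rewrite -big_enum_val; apply: eq_bigl. Qed.

Lemma sum_pair_snd (V : nmodType) (f : 'I_m * 'I_m -> V) (v : 'I_m) :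
  \sum_x f x *+ (x.2 == v) = \sum_u f (u, v).
Proof.
transitivity (\sum_u \sum_w f (u, w) *+ (w == v)).
  by rewrite pair_bigA; apply: eq_bigr => -[].
apply: eq_bigr => u _; rewrite (bigD1 v) //= eqxx big1 ?addr0 // => w.
by move=> /negPf ->.
Qed.

Lemma rows_copies_mx (M N : 'M_m) :
  rows_mx M *m copies_mx N = rows_mx (M *m N).
Proof.
apply/matrixP => i b; rewrite !mxE.
under eq_bigr do rewrite !mxE mulrnAr.
rewrite (sum_enum_val (fun a : 'I_m * 'I_m =>
  ((M (enum_val i).2 a.1 *+ (a.2 == (enum_val i).1) +
   M (enum_val i).1 a.1 *+ (a.2 == (enum_val i).2)) *
  N a.1 (enum_val b).1) *+ (a.2 == (enum_val b).2))) sum_pair_snd /=.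
rewrite -!sumrMnl -big_split /=; apply: eq_bigr => u _.
by rewrite mulrDl !mulrnAl.
Qed.

Lemma copies_mxM (A N : 'M_m) :
  copies_mx A *m copies_mx N = copies_mx (A *m N).
Proof.
apply/matrixP => a b; rewrite !mxE.
under eq_bigr do rewrite !mxE mulrnAr.
rewrite (sum_enum_val (fun x : 'I_m * 'I_m =>
  ((A (enum_val a).1 x.1 *+ ((enum_val a).2 == x.2)) *
  N x.1 (enum_val b).1) *+ (x.2 == (enum_val b).2))) sum_pair_snd /=.
by rewrite -!sumrMnl; apply: eq_bigr => u _; rewrite mulrnAl.
Qed.

Lemma copies_mx1 : copies_mx 1%:M = 1%:M.
Proof.
apply/matrixP => a b; rewrite !mxE -(inj_eq enum_val_inj).
by case: (enum_val a) (enum_val b) => [u v] [u' v'] /=; rewrite xpair_eqE mulrb;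
  case: (u == u'); case: (v == v').
Qed.

Lemma invmx_copies (A : 'M_m) : A \in unitmx ->
  copies_mx A \in unitmx /\ invmx (copies_mx A) = copies_mx (invmx A).
Proof.
move=> Au; have AN : copies_mx A *m copies_mx (invmx A) = 1%:M.
  by rewrite copies_mxM mulmxV // copies_mx1.
have [Ku _] := mulmx1_unit AN; split=> //.
by rewrite -[RHS]mul1mx -(mulVmx Ku) -mulmxA AN mulmx1.
Qed.

Lemma rows_edges_mx (M : 'M_m) : rows_mx M *m edges_mx = jacobian M.
Proof.
apply/matrixP => i j; rewrite !mxE.
rewrite (bigD1 (enum_rank (enum_val j))) //= big1 ?addr0 => [|a].
  by rewrite !mxE enum_rankK eqxx mulr1.
rewrite -(inj_eq enum_val_inj) enum_rankK => /negPf aj.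
by rewrite !mxE aj mulr0.
Qed.

(** This displays the Jacobian as a Schur complement, whose block matrix has only entries of [O],
    [A] and 0, 1, hence entries supported on the graph. *)
Lemma jacobian_factor (O A : 'M_m) : A \in unitmx ->
  jacobian (O *m invmx A) = rows_mx O *m invmx (copies_mx A) *m edges_mx.
Proof.
by move=> Au; rewrite (invmx_copies Au).2 rows_copies_mx rows_edges_mx.
Qed.

End JacobianMatrix.

(** Here [ws] is the whole right side. If it begins with the source [w], the first edge is directed
    and the encoding omits the source; otherwise the first edge is bidirected. *)
Definition halftrek_of (m : nat) (w : 'I_m) (ws : seq 'I_m) : bool * seq 'I_m :=
  if w == head w ws then (false, behead ws) else (true, ws).

Lemma halftrek_ofP (m : nat) (D B : rel 'I_m) (w s : 'I_m) (ws : seq 'I_m) :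
  w = s \/ B w s -> path D s ws ->
  [/\ is_half_trek D B w (halftrek_of w (s :: ws)),
      ht_target w (halftrek_of w (s :: ws)) = last s ws
    & ht_right w (halftrek_of w (s :: ws)) = s :: ws].
Proof.
rewrite /halftrek_of /= => wBs Dws.
case: eqP => [-> | neq_ws]; first by split.
by case: wBs => // Bws; split; rewrite /is_half_trek //= Bws.
Qed.

(** In a pair indexing the block [A (x) I] the first component is the current vertex of a half-trek,
    and the second one, the copy, stays equal to the vertex [v] whose parents are to be reached. *)
Lemma full_rank_HTC (F : fieldType) (m : nat) (D B : rel 'I_m)
    (O A : 'M[F]_m) :
  mixed_graph D B ->
  (forall i j, A i j != 0 -> i = j \/ D i j) ->
  (forall i j, O i j != 0 -> i = j \/ B i j) ->
  A \in unitmx -> row_full (jacobian D B (O *m invmx A)) ->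
  exists Y : 'I_m -> {set 'I_m}, (forall v, HTC D B (Y v) v) /\
    ~ exists v w, v != w /\ v \in Y w /\ w \in Y v.
Proof.
move=> [_ [_ Bsym]] suppA suppO Au Jfull.
have := fullrowsub_unit Jfull; set f := fullrankfun Jfull.
have f_inj : injective f by exact: fullrankfun_inj.
rewrite jacobian_factor // -!mul_rowsub_mx.
move/(unitmx_schur (invmx_copies Au).1); rewrite unitmxE unitfE.
move=> /det_neq0_perm; set n := #|edges D|; set p := #|{: 'I_m * 'I_m}|.
move=> [s s_neq0].
have s_inj : injective s by exact: perm_inj.
have [k kP] := first_return (fun x : 'I_(p + n) => (p <= x)%N) s_inj.
(* Indices are decoded as columns, so one past [p] is an edge. Read as a row, the same index is a
   chosen nonadjacent pair; identifying the two readings is what allows [s] to be iterated. *)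
pose vtx (x : 'I_(p + n)) : 'I_m * 'I_m :=
  match split x with inl a => enum_val a | inr j => enum_val j end.
have vtxl a : vtx (lshift n a) = enum_val a by rewrite /vtx (unsplitK (inl a)).
have vtxr j : vtx (rshift p j) = enum_val j by rewrite /vtx (unsplitK (inr j)).
have Pr (j : 'I_n) : (p <= rshift p j)%N by rewrite leq_addr.
have Pl (a : 'I_p) : (p <= lshift n a)%N = false.
  by rewrite /= leqNgt ltn_ord.
have step a : (p <= s (lshift n a))%N = false ->
   (vtx (lshift n a)).2 = (vtx (s (lshift n a))).2 /\
   (s (lshift n a) = lshift n a \/
    D (vtx (lshift n a)).1 (vtx (s (lshift n a))).1).
  have := s_neq0 (lshift n a); case: (split_ordP (s (lshift n a))) => b ->.
    rewrite block_mxEul mxE mulrb !vtxl;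
    case: ifP => [/eqP e2|_]; last by rewrite eqxx.
    move=> /suppA[e1 _|Dab _]; split=> //; last by right.
    left; congr lshift; apply: enum_val_inj.
    by case: (enum_val a) (enum_val b) e1 e2 => [u v] [u' v'] /= -> ->.
  by rewrite Pr.
have stepend a : (p <= s (lshift n a))%N ->
    vtx (lshift n a) = vtx (s (lshift n a)).
  have := s_neq0 (lshift n a); case: (split_ordP (s (lshift n a))) => b ->.
    by rewrite Pl.
  by rewrite block_mxEur mxE vtxl vtxr; case: (_ =P enum_val b) => //;
    rewrite eqxx.
(* The shift by one makes [node i 0] the column met in row [i] of [C], which is the first vertex on
   the right side. *)
pose node i t : 'I_(p + n) := iter t.+1 s (rshift p i).
(* [c i] is the endpoint served by row [i], read off as the copy that the first step enters; the
   other endpoint [o i] will belong to [Y (c i)]. *)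
pose c i := (vtx (node i 0)).2.
pose pr i := enum_val (f i).
have prP i : ((pr i).1 < (pr i).2)%N && ~~ B (pr i).1 (pr i).2.
  by have := enum_valP (f i); rewrite inE.
pose o i := if c i == (pr i).1 then (pr i).2 else (pr i).1.
(* The zero block forces the first step into a column of [C], and the nonzero entry found there is
   an entry of [O] in row [o i]. *)
have startP i : [/\ (p <= node i 0)%N = false,
    c i = (pr i).1 \/ c i = (pr i).2
    & o i = (vtx (node i 0)).1 \/ B (o i) (vtx (node i 0)).1].
  rewrite /o /c /node /=; have := s_neq0 (rshift p i).
  case: (split_ordP (s (rshift p i))) => b ->; last first.
    by rewrite block_mxEdr mxE eqxx.
  rewrite block_mxEdl 2!mxE /= !vtxl Pl -/(pr i).
  have [e1|_] := eqVneq _ (pr i).1.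
    have -> : ((enum_val b).2 == (pr i).2) = false.
      by rewrite e1; apply/negbTE; rewrite neq_ltn (andP (prP i)).1.
    by rewrite addr0 => /suppO H; split=> //; left.
  have [e2|_] := eqVneq _ (pr i).2; last by rewrite addr0 eqxx.
  by rewrite add0r => /suppO H; split=> //; right.
have coP i : (c i = (pr i).1 /\ o i = (pr i).2) \/
             (c i = (pr i).2 /\ o i = (pr i).1).
  have [_ ci _] := startP i; have /andP[lt _] := prP i; move: ci.
  rewrite /o; case: eqP => [-> _|neq []//]; [by left | by right].
(* An unordered pair determines its row. The first case makes the half-trek of a source well
   defined; the second excludes [v] in [Y w] together with [w] in [Y v]. *)
have pr_eq i i' : (c i = c i' /\ o i = o i') \/ (c i = o i' /\ o i = c i') ->
    i = i'.
  move=> H; apply/f_inj/enum_val_inj; rewrite -/(pr i) -/(pr i').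
  move: H (coP i) (coP i') (prP i) (prP i').
  case: (pr i) (pr i') => [x y] [x' y'] /= H Hi Hi' /andP[xy _] /andP[x'y' _].
  have [[ex ey] | [ex ey]] : (x = x' /\ y = y') \/ (x = y' /\ y = x').
  - by case: Hi Hi' H => -[-> ->] [] [-> ->] [] [-> ->]; auto.
  - by rewrite ex ey.
  - by move: xy x'y'; rewrite ex ey; lia.
have co i : c i != o i /\ ~~ B (o i) (c i).
  have /andP[lt nB] := prP i.
  by case: (coP i) => -[-> ->]; rewrite neq_ltn lt ?orbT ?nB // Bsym.
pose K i := k (rshift p i).
have K_P i : [/\ (1 < K i)%N, (p <= node i (K i).-1)%N
    & forall t, (t.+1 < K i)%N -> (p <= node i t)%N = false].
  have [k_gt0 Pk Nk] := kP _ (Pr i); have [N0 _ _] := startP i.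
  have K_gt1 : (1 < K i)%N.
    rewrite /K; move: Pk k_gt0; case: (k _) => [|[|k']] //.
    by rewrite -[iter _ _ _]/(node i 0) N0.
  split=> // [|t tk]; first by rewrite /node prednK // ltnW.
  exact/negbTE/Nk.
have node_disj i i' t t' : (t < K i)%N -> (t' < K i')%N ->
    node i t = node i' t' -> i = i'.
  move=> tK tK' e; apply: (@rshift_inj p n).
  have Nk (z : 'I_(p + n)) : (p <= z)%N ->
      forall t, (0 < t < k z)%N -> ~~ (p <= iter t s z)%N by case/kP.
  exact: (first_return_disjoint s_inj Nk (Pr i) (Pr i') _ _ e).
(* A diagonal entry of [A] would make the node a fixed point of [s]; its orbit would then be a
   single index below [p], yet that orbit contains row [i]. *)
have node_step i t : (t.+2 < K i)%N ->
    (vtx (node i t)).2 = (vtx (node i t.+1)).2 /\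
    D (vtx (node i t)).1 (vtx (node i t.+1)).1.
  move=> tK; have [_ _ NK] := K_P i.
  have := NK t.+1 tK; have := NK t (ltnW tK).
  rewrite -[node i t.+1]/(s (node i t)).
  have [a E|j E] := split_ordP (node i t); rewrite E; last by rewrite Pr.
  move=> _ /step[e2 [fixa|Da]]; last by split.
  have : node i t = iter t.+1 s (node i 0).
    by rewrite -iterSr -[RHS]/(s (node i t)) E fixa.
  rewrite /node => /(@iter_inj _ s t.+1 s_inj) e.
  by have [N0 _ _] := startP i; rewrite /node -e Pr in N0.
have node_c i t : (t.+1 < K i)%N -> (vtx (node i t)).2 = c i.
  elim: t => // t IH tK; have [<- _] := node_step i t tK.
  exact/IH/ltnW.
(* The edge at which the permutation first arrives in a column of [E]. Its tail is the target of the
   half-trek and its head is [c i]. *)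
pose e i := vtx (node i (K i).-1).
have e_last i : e i = vtx (node i (K i).-2).
  have [K_gt1 PK NK] := K_P i; move: PK; rewrite /e.
  have -> : (K i).-1 = (K i).-2.+1 by lia.
  have := NK (K i).-2 ltac:(lia); rewrite -[node i _.+1]/(s (node i _)).
  case: (split_ordP (node i (K i).-2)) => [a ->|j ->]; last by rewrite Pr.
  by move=> _ /stepend.
have e2 i : (e i).2 = c i.
  by rewrite e_last node_c //; have [K_gt1 _ _] := K_P i; lia.
have eE i : exists2 j, node i (K i).-1 = rshift p j & e i = enum_val j.
  have [_ + _] := K_P i; rewrite /e.
  by case: (split_ordP (node i (K i).-1)) => [a ->|j -> _]; rewrite ?Pl //;
    exists j.
have e_inj : injective e.
  move=> i i'; have [j ej ->] := eE i; have [j' ej' ->] := eE i'.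
  move=> /enum_val_inj ejj; have [? _ _] := K_P i; have [? _ _] := K_P i'.
  apply: (node_disj i i' (K i).-1 (K i').-1); rewrite ?ej ?ej' ?ejj //; lia.
(* There are as many half-treks as edges, so distinct final edges exhaust [edges D], and every
   parent of every vertex is a target. *)
have e_im : [set e i | i : 'I_n] = edges D.
  apply/eqP; rewrite eqEcard card_imset // card_ord leqnn andbT.
  by apply/subsetP => _ /imsetP[i _ ->]; have [j _ ->] := eE i; exact: enum_valP.
pose g i t := (vtx (node i t)).1.
pose ws i := map (g i) (iota 1 (K i).-2).
have ws_path i : path D (g i 0) (ws i).
  apply: path_map_iota => t t_lt; apply: (node_step i t _).2; lia.
have ws_last i : last (g i 0) (ws i) = (e i).1.
  by rewrite last_map_iota e_last.
have ws_mem i x : x \in g i 0 :: ws i ->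
    exists2 t, (t.+1 < K i)%N & x = (vtx (node i t)).1.
  have -> : g i 0 :: ws i = map (g i) (iota 0 (K i).-2.+1) by [].
  case/mapP => t; rewrite mem_iota => t_lt ->; exists t => //.
  by have [? _ _] := K_P i; lia.
have ht i : [/\ is_half_trek D B (o i) (halftrek_of (o i) (g i 0 :: ws i)),
    ht_target (o i) (halftrek_of (o i) (g i 0 :: ws i)) = (e i).1
  & ht_right (o i) (halftrek_of (o i) (g i 0 :: ws i)) = g i 0 :: ws i].
  by rewrite -ws_last; have [_ _ H] := startP i; exact: halftrek_ofP.
(* A system assigns a half-trek to each source, so the row is recovered from head and source.
   Outside [Y v] the values of [tgt] and [pth] are dummies. *)
pose idx v x := [pick i | (c i == v) && (o i == x)].
have idxE i : idx (c i) (o i) = Some i.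
  rewrite /idx; case: pickP => [i' /andP[/eqP ec /eqP eo]|/(_ i)].
    by congr Some; apply: pr_eq; left.
  by rewrite !eqxx.
pose Y v := [set o i | i : 'I_n & c i == v].
have YP v x : x \in Y v -> exists2 i, c i = v & o i = x.
  by case/imsetP => i; rewrite inE => /eqP ci ->; exists i.
exists Y; split=> [v|[v [w [vw []]]]]; last first.
  move=> /YP[i ci oi] /YP[i' ci' oi']; case/negP: vw.
  by rewrite -ci' -ci (pr_eq i i') //; right; rewrite ci oi.
pose tgt x := if idx v x is Some i then (e i).1 else x.
pose pth x := if idx v x is Some i then halftrek_of x (g i 0 :: ws i)
              else (false, [::]).
have tgtE i : c i = v -> tgt (o i) = (e i).1 by move=> ci; rewrite /tgt -ci idxE.
have pthE i : c i = v -> pth (o i) = halftrek_of (o i) (g i 0 :: ws i).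
  by move=> ci; rewrite /pth -ci idxE.
have tgt_inj : {in Y v &, injective tgt}.
  move=> _ _ /YP[i ci <-] /YP[i' ci' <-]; rewrite !tgtE // => e1.
  congr o; apply: e_inj; rewrite [LHS]surjective_pairing [RHS]surjective_pairing.
  by rewrite e1 !e2 ci ci'.
have tgt_im : tgt @: Y v = pa D v.
  apply/setP => u; apply/imsetP/idP => [[_ /YP[i ci <-] ->]|].
    rewrite tgtE // inE -ci -e2.
    have : e i \in edges D by rewrite -e_im imset_f.
    by rewrite inE.
  rewrite inE => Duv; have : (u, v) \in edges D by rewrite inE.
  rewrite -e_im => /imsetP[i _ ei].
  have ci : c i = v by rewrite -e2 -ei.
  exists (o i); last by rewrite tgtE // -ei.
  by apply/imsetP; exists i; rewrite ?inE ?ci.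
have cardY : #|Y v| = #|pa D v| by rewrite -tgt_im (card_in_imset tgt_inj).
split=> //; split.
  apply/setP => x; rewrite !inE; apply/negbTE/negP => /andP[/YP[i ci <-]].
  have [neq nB] := co i; rewrite -ci => /orP[]; last exact/negP.
  by rewrite eq_sym; exact/negP.
split=> //; exists tgt, pth; split=> [_ /YP[i ci <-]|].
  by rewrite pthE // tgtE //; have [-> -> _] := ht i.
split=> //; split=> //; split=> [x x' _ _ xx'|].
  by rewrite disjoint_has /= orbF inE.
move=> _ _ /YP[i ci <-] /YP[i' ci' <-] neq; rewrite !pthE //.
have [_ _ ->] := ht i; have [_ _ ->] := ht i'.
(* Both half-treks stay in copy [v], so a common vertex is a common index of the block matrix, and
   [node_disj] identifies the rows. *)
rewrite disjoint_has; apply: contra neq => /hasP[x].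
move=> /ws_mem[t tK ->] /ws_mem[t' tK' e1]; apply/eqP; congr o.
have [_ _ NK] := K_P i; have [_ _ NK'] := K_P i'.
have := NK _ tK; have := NK' _ tK'; have := node_c _ _ tK; have := node_c _ _ tK'.
have := @node_disj i i' t t' (ltnW tK) (ltnW tK'); move: e1.
case: (split_ordP (node i t)) => [a ->|j ->]; last by rewrite Pr.
case: (split_ordP (node i' t')) => [a' ->|j ->]; last by rewrite Pr.
rewrite !vtxl => e1 H c2 c1 _ _; apply: H; congr lshift; apply: enum_val_inj.
rewrite [LHS]surjective_pairing [RHS]surjective_pairing.
by rewrite e1 c1 c2 ci ci'.
Qed.

(** * Polynomial functions and Euler polygons *)

Section BoundedClusterPoint.
Import numFieldNormedType.Exports.
Local Open Scope classical_set_scope.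
Local Open Scope ring_scope.

(** A product of segments is compact by Tychonoff's theorem. As [X] is finite, closeness in all
    coordinates at once is a neighbourhood for the product topology. *)
Lemma bounded_cluster_point (K : realType) (X : finType) (u : nat -> X -> K)
    (c : X -> K) (r : K) :
  (forall n x, `|u n x - c x| <= r) ->
  exists l : X -> K, forall e, 0 < e -> forall N, exists2 n, (N <= n)%N &
    forall x, `|u n x - l x| < e.
Proof.
move=> u_r.
have := @tychonoff X (fun=> K) (fun x => `[c x - r, c x + r]%classic)
  (fun x => @segment_compact _ _ _).
move=> /(_ (u @ \oo)) [].
  exists 0%N => // n _ x /=; rewrite in_itv /=.
  by have := u_r n x; rewrite ler_norml; lra.
move=> l [_ l_cluster]; exists l => e e_gt0 N.
pose T : topologicalType := @prod_topology X (fun=> K : topologicalType).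
have nx x : nbhs (l : T) [set f : T | ball (l x) e (f x)].
  exact: (@proj_continuous X (fun=> K) x l _ (nbhsx_ballx (l x) e e_gt0)).
have nl : nbhs (l : T) [set f : T | forall x, ball (l x) e (f x)].
  exact: (@filter_forall T X (fun x (f : T) => ball (l x) e (f x)) _
    (nbhs_filter (l : T)) nx).
have [] := l_cluster [set f | exists2 n, (N <= n)%N & f = u n] _ _ nl.
  by exists N => // n /= Nn; exists n.
move=> _ [[n Nn ->] H]; exists n => // x.
by have := H x; rewrite /ball /= distrC.
Qed.

End BoundedClusterPoint.

(** * Polynomial functions and their Lipschitz bounds *)

Definition polyfun (X : Type) (f : (X -> R) -> R) : Prop :=
  exists p : rpoly X, forall e, peval e p = f e.

Definition polyfun_mx (X : Type) (m n : nat) (f : (X -> R) -> 'M[R]_(m, n)) :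
    Prop :=
  forall i j, polyfun (fun e => f e i j).

Section PolynomialFunctions.
Variable X : Type.
Implicit Types f g : (X -> R) -> R.

Lemma eq_polyfun f g : f =1 g -> polyfun f -> polyfun g.
Proof. by move=> fg [p pf]; exists p => e; rewrite pf fg. Qed.

Lemma polyfun_const c : polyfun (fun _ : X -> R => c).
Proof. by exists (PConst X c). Qed.

Lemma polyfun_var (x : X) : polyfun (fun e => e x).
Proof. by exists (PVar x). Qed.

Lemma polyfunD f g : polyfun f -> polyfun g -> polyfun (fun e => f e + g e).
Proof. by move=> [p pf] [q qg]; exists (PAdd p q) => e /=; rewrite pf qg. Qed.

Lemma polyfunM f g : polyfun f -> polyfun g -> polyfun (fun e => f e * g e).
Proof. by move=> [p pf] [q qg]; exists (PMul p q) => e /=; rewrite pf qg. Qed.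

Lemma polyfunN f : polyfun f -> polyfun (fun e => - f e).
Proof.
move=> pf; apply: eq_polyfun (polyfunM (polyfun_const (-1)) pf) => e.
by rewrite mulN1r.
Qed.

Lemma polyfunB f g : polyfun f -> polyfun g -> polyfun (fun e => f e - g e).
Proof. by move=> pf /polyfunN; exact: polyfunD. Qed.

Lemma polyfun_sum (I : Type) (s : seq I) (P : pred I) (F : I -> (X -> R) -> R) :
  (forall i, polyfun (F i)) -> polyfun (fun e => \sum_(i <- s | P i) F i e).
Proof.
move=> pF; elim: s => [|i s IH].
  by apply: eq_polyfun (polyfun_const 0) => e; rewrite big_nil.
apply: (@eq_polyfun (fun e => (if P i then F i e else 0) +
  \sum_(i <- s | P i) F i e)) => [e|].
  by rewrite big_cons; case: ifP; rewrite ?add0r.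
apply: polyfunD => //; case: (P i) => //; exact: polyfun_const.
Qed.

Lemma polyfun_prod (I : Type) (s : seq I) (P : pred I) (F : I -> (X -> R) -> R) :
  (forall i, polyfun (F i)) -> polyfun (fun e => \prod_(i <- s | P i) F i e).
Proof.
move=> pF; elim: s => [|i s IH].
  by apply: eq_polyfun (polyfun_const 1) => e; rewrite big_nil.
apply: (@eq_polyfun (fun e => (if P i then F i e else 1) *
  \prod_(i <- s | P i) F i e)) => [e|].
  by rewrite big_cons; case: ifP; rewrite ?mul1r.
apply: polyfunM => //; case: (P i) => //; exact: polyfun_const.
Qed.

Lemma polyfun_mxM m n p (f : (X -> R) -> 'M_(m, n)) (g : (X -> R) -> 'M_(n, p)) :
  polyfun_mx f -> polyfun_mx g -> polyfun_mx (fun e => f e *m g e).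
Proof.
move=> pf pg i j.
apply: (@eq_polyfun (fun e => \sum_k f e i k * g e k j)) => [e|].
  by rewrite mxE.
by apply: polyfun_sum => k; apply: polyfunM.
Qed.

Lemma polyfun_det n (f : (X -> R) -> 'M_n) :
  polyfun_mx f -> polyfun (fun e => \det (f e)).
Proof.
move=> pf; apply: polyfun_sum => s; apply: polyfunM; first exact: polyfun_const.
by apply: polyfun_prod => i; exact: pf.
Qed.

Lemma polyfun_adj n (f : (X -> R) -> 'M_n) :
  polyfun_mx f -> polyfun_mx (fun e => \adj (f e)).
Proof.
move=> pf i j.
apply: (@eq_polyfun (fun e => cofactor (f e) j i)) => [e|]; first by rewrite mxE.
apply: polyfunM; first exact: polyfun_const.
apply: polyfun_det => k l.
apply: (@eq_polyfun (fun e => f e (lift j k) (lift i l))).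
  by move=> e; rewrite !mxE.
exact: pf.
Qed.

(* The bound is linear in [r] only because [r <= 1]. *)
Lemma polyfun_lipschitz f (e0 : X -> R) : polyfun f ->
  exists2 K, 0 <= K & forall r e, 0 <= r <= 1 ->
    (forall x, `|e x - e0 x| <= r) -> `|f e - f e0| <= K * r.
Proof.
move=> [p pf]; suff [K K0 HK] : exists2 K, 0 <= K & forall r e, 0 <= r <= 1 ->
    (forall x, `|e x - e0 x| <= r) -> `|peval e p - peval e0 p| <= K * r.
  by exists K => // r e r01 er; rewrite -!pf; exact: HK.
elim: p {f pf} => [c|x|p [K K0 HK] q [L L0 HL]|p [K K0 HK] q [L L0 HL]] /=.
- by exists 0 => // r e _ _; rewrite subrr normr0 mul0r.
- by exists 1 => // r e _ er; rewrite mul1r.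
- exists (K + L) => [|r e r01 er]; first exact: addr_ge0.
  rewrite !RplusE opprD addrACA mulrDl.
  exact: le_trans (ler_normD _ _) (lerD (HK _ _ r01 er) (HL _ _ r01 er)).
- set P := peval e0 p; set Q := peval e0 q.
  exists (K * (`|Q| + L) + `|P| * L) => [|r e r01 er].
    by rewrite addr_ge0 ?mulr_ge0 ?addr_ge0.
  have hp := HK _ _ r01 er; have hq := HL _ _ r01 er.
  have [r0 r1] := andP r01.
  rewrite !RmultE -/P -/Q in hp hq *.
  have -> : peval e p * peval e q - P * Q =
    (peval e p - P) * peval e q + P * (peval e q - Q) by ring.
  apply: le_trans (ler_normD _ _) _; rewrite !normrM mulrDl lerD //.
    have hQ : `|peval e q| <= `|Q| + L.
      have -> : peval e q = Q + (peval e q - Q) by ring.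
      apply: le_trans (ler_normD _ _) _; rewrite lerD2l.
      by apply: le_trans hq _; rewrite ler_piMr.
    by rewrite mulrAC ler_pM.
  by rewrite -mulrA ler_wpM2l.
Qed.

End PolynomialFunctions.

(** * Boundedness on a set and on small boxes *)

Definition bounded_on (T : Type) (P : T -> Prop) (f : T -> R) : Prop :=
  exists K, forall t, P t -> `|f t| <= K.

Section BoundedFunctions.
Variables (T : Type) (P : T -> Prop).
Implicit Types f g : T -> R.

Lemma bounded_onM f g :
  bounded_on P f -> bounded_on P g -> bounded_on P (fun t => f t * g t).
Proof.
move=> [K HK] [L HL]; exists (K * L) => t Pt.
by rewrite normrM ler_pM ?HK ?HL.
Qed.

Lemma bounded_on_sum (I : finType) (F : I -> T -> R) :
  (forall i, bounded_on P (F i)) -> bounded_on P (fun t => \sum_i F i t).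
Proof.
move=> bF; elim: (index_enum I) => [|i s [K IH]].
  by exists 0 => t _; rewrite big_nil normr0.
have [L HL] := bF i; exists (L + K) => t Pt; rewrite big_cons.
exact: le_trans (ler_normD _ _) (lerD (HL _ Pt) (IH _ Pt)).
Qed.

Lemma bounded_on_mxM m n p (f : T -> 'M_(m, n)) (g : T -> 'M_(n, p)) :
  (forall i j, bounded_on P (fun t => f t i j)) ->
  (forall i j, bounded_on P (fun t => g t i j)) ->
  forall i j, bounded_on P (fun t => (f t *m g t) i j).
Proof.
move=> bf bg i j.
have [K HK] : bounded_on P (fun t => \sum_k f t i k * g t k j).
  by apply: bounded_on_sum => k; apply: bounded_onM.
by exists K => t Pt; rewrite mxE HK.
Qed.

Lemma bounded_on_uniform (I : finType) (F : I -> T -> R) :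
  (forall i, bounded_on P (F i)) ->
  exists2 K, 0 <= K & forall i t, P t -> `|F i t| <= K.
Proof.
move=> bF; have [K HK] : bounded_on P (fun t => \sum_i `|F i t|).
  apply: bounded_on_sum => i; have [K HK] := bF i.
  by exists K => t Pt; rewrite normr_id HK.
(* The absolute value secures a nonnegative bound even when [P] is empty. *)
exists `|K| => // i t Pt; apply: le_trans (ler_norm K); apply: le_trans (HK _ Pt).
by rewrite (bigD1 i) //=; apply: le_trans (ler_norm _); rewrite lerDl sumr_ge0.
Qed.

End BoundedFunctions.

Definition box (X : Type) (c : X -> R) (r : R) (e : X -> R) : Prop :=
  forall x, `|e x - c x| <= r.

Lemma polyfun_bounded (X : Type) (f : (X -> R) -> R) (c : X -> R) (r : R) :
  0 <= r <= 1 -> polyfun f -> bounded_on (box c r) f.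
Proof.
move=> r01 /(polyfun_lipschitz c)[K K0 HK]; exists (K * r + `|f c|) => e er.
have -> : f e = (f e - f c) + f c by ring.
by apply: le_trans (ler_normD _ _) _; rewrite lerD2r HK.
Qed.

Lemma polyfun_neq0_near (X : Type) (f : (X -> R) -> R) (c : X -> R) :
  polyfun f -> f c != 0 ->
  exists r d, [/\ 0 < r <= 1, 0 < d & forall e, box c r e -> d <= `|f e|].
Proof.
move=> /(polyfun_lipschitz c)[K K0 HK] fc.
have fc0 : 0 < `|f c| by rewrite normr_gt0.
(* This radius limits the variation of [f] to half of its absolute value at [c]; [K + 1] keeps the
   denominator positive when [K = 0]. *)
pose r := Num.min 1 (`|f c| / (2 * (K + 1))).
have rK : r * (2 * (K + 1)) <= `|f c|.
  rewrite -ler_pdivlMr; first by rewrite ge_min lexx orbT.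
  lra.
have r0 : 0 < r by rewrite lt_min ltr01 divr_gt0 //; lra.
have r1 : r <= 1 by rewrite ge_min lexx.
exists r, (`|f c| / 2); rewrite r0 r1 divr_gt0 //; split=> // e er.
have := HK r e _ er; rewrite r1 ltW // => /(_ isT) H.
have := lerB_normD (f c) (f e - f c).
have -> : f c + (f e - f c) = f e by ring.
move: H; nra.
Qed.

(* Euler polygon with [n.+1] steps of length [d / n.+1]: the one-step defect is
   of second order, so the total drift of [Phi] tends to 0. *)
Lemma euler_polygon (X J : Type) (x0 : X) (c : X -> R) (r K L : R)
    (Lin : (X -> R) -> Prop) (V : (X -> R) -> X -> R)
    (Phi : (X -> R) -> J -> R) :
  Lin c -> 0 <= K ->
  (forall e h, Lin e -> box c r e -> Lin (fun x => e x + h * V e x)) ->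
  (forall e x, Lin e -> box c r e -> `|V e x| <= K) ->
  (forall e, Lin e -> box c r e -> V e x0 = 1) ->
  (forall e h j, Lin e -> box c r e -> box c r (fun x => e x + h * V e x) ->
     `|Phi (fun x => e x + h * V e x) j - Phi e j| <= L * h ^+ 2) ->
  forall d n, 0 < d -> d * K <= r ->
  exists e, [/\ Lin e, box c r e, e x0 = c x0 + d
    & forall j, `|Phi e j - Phi c j| <= L * d ^+ 2 / n.+1%:R].
Proof.
move=> Linc K0 LinV VK Vx0 PhiV d n d0 dKr.
pose h := d / n.+1%:R.
have n1 : 0 < n.+1%:R :> R by rewrite ltr0n.
have h0 : 0 < h by rewrite divr_gt0.
have hn : n.+1%:R * h = d by rewrite mulrC divfK // gt_eqF.
(* The induction tracks the distance travelled after [k] steps, so that every vertex of the polygon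
   is known to lie in the box of radius [r]. *)
suff /(_ n.+1 (leqnn _)) [e [Le be ex0 Pe]] : forall k, (k <= n.+1)%N ->
    exists e, [/\ Lin e, box c (k%:R * h * K) e, e x0 = c x0 + k%:R * h
      & forall j, `|Phi e j - Phi c j| <= k%:R * (L * h ^+ 2)].
  exists e; split=> //.
  - by move=> x; apply: le_trans (be x) _; rewrite hn.
  - by rewrite ex0 hn.
  - move=> j; apply: le_trans (Pe j) _; rewrite -hn.
    have -> : L * (n.+1%:R * h) ^+ 2 / n.+1%:R = n.+1%:R * (L * h ^+ 2).
      by field; rewrite addrC natr1 gt_eqF.
    exact: lexx.
have sub k : (k <= n.+1)%N -> k%:R * h * K <= r.
  move=> kn; apply: le_trans dKr; rewrite ler_wpM2r // -hn.
  by apply: ler_wpM2r; [exact: ltW | rewrite ler_nat].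
elim=> [_|k IH kn].
  exists c; split=> //; first by move=> x; rewrite subrr normr0 mul0r mul0r.
    by rewrite mul0r addr0.
  by move=> j; rewrite subrr normr0 mul0r.
have [e [Le be ex0 Pe]] := IH (ltnW kn).
have ber : box c r e by move=> x; apply: le_trans (be x) _; rewrite sub // ltnW.
have be' : box c (k.+1%:R * h * K) (fun x => e x + h * V e x).
  move=> x; rewrite addrAC; apply: le_trans (ler_normD _ _) _.
  rewrite -natr1 !mulrDl mul1r lerD ?be // normrM gtr0_norm //.
  by rewrite ler_wpM2l ?VK // ltW.
have ber' : box c r (fun x => e x + h * V e x).
  by move=> x; apply: le_trans (be' x) _; exact: sub.
exists (fun x => e x + h * V e x); split=> //; first exact: LinV.
  by rewrite Vx0 // ex0 -natr1; ring.
move=> j; rewrite -natr1 mulrDl mul1r.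
have -> : Phi (fun x => e x + h * V e x) j - Phi c j =
  (Phi e j - Phi c j) + (Phi (fun x => e x + h * V e x) j - Phi e j) by ring.
by apply: le_trans (ler_normD _ _) _; rewrite lerD // PhiV.
Qed.

Lemma polyfun_cluster_eq0 (X : Type) (f : (X -> R) -> R) (u : nat -> X -> R)
    (l : X -> R) (C : R) :
  polyfun f ->
  (forall e, 0 < e -> forall N, exists2 n, (N <= n)%N &
    forall x, `|u n x - l x| < e) ->
  (forall n, `|f (u n)| <= C / n.+1%:R) -> f l = 0.
Proof.
move=> /(polyfun_lipschitz l)[K K0 HK] ul fu; apply/eqP/contraT => fl.
have t0 : 0 < `|f l| by rewrite normr_gt0.
set t := `|f l| in t0 *.
have C0 : 0 <= C.
  by have := le_trans (normr_ge0 _) (fu 0%N); rewrite divr1.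
(* Radius and index make the Lipschitz error and [C / n.+1] at most a quarter of [t] each, which
   contradicts that [f l] has absolute value [t]. *)
pose r := Num.min 1 (t / (4 * (K + 1))).
have rK : r * (4 * (K + 1)) <= t.
  rewrite -ler_pdivlMr; first by rewrite ge_min lexx orbT.
  lra.
have r0 : 0 < r by rewrite lt_min ltr01 divr_gt0 //; lra.
have r1 : r <= 1 by rewrite ge_min lexx.
have [n Nn un] := ul r r0 (Num.bound (4 * C / t)).
have Cn : C / n.+1%:R <= t / 4.
  rewrite ler_pdivrMr ?ltr0n //.
  have := @archi_boundP R (4 * C / t) _; rewrite divr_ge0 ?mulr_ge0 ?(ltW t0) //.
  move=> /(_ isT); rewrite ltr_pdivrMr // => H.
  have : (Num.bound (4 * C / t))%:R <= n.+1%:R :> R by rewrite ler_nat ltnW.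
  move: H; set b := (Num.bound _)%:R; set a := n.+1%:R => H ba.
  have : t * b <= t * a by rewrite ler_wpM2l // ltW.
  by move: H; lra.
have := HK r (u n) _ (fun x => ltW (un x)); rewrite r1 ltW // => /(_ isT) H.
have := ler_normB (f (u n)) (f (u n) - f l).
have -> : f (u n) - (f (u n) - f l) = f l by ring.
have := le_trans (fu n) Cn; rewrite -/t.
have : K * r * 4 + r * 4 <= t by move: rK; lra.
by move: H; lra.
Qed.

(** The point is a cluster point of polygon endpoints as the number of steps grows. For arbitrary
    [Lin] and [Phi] it inherits the polynomial identities that are controlled by the drift of
    [Phi]. *)
Lemma euler_limit (X : finType) (J : Type) (x0 : X) (c : X -> R) (r K L : R)
    (Lin : (X -> R) -> Prop) (V : (X -> R) -> X -> R)
    (Phi : (X -> R) -> J -> R) :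
  Lin c -> 0 <= K ->
  (forall e h, Lin e -> box c r e -> Lin (fun x => e x + h * V e x)) ->
  (forall e x, Lin e -> box c r e -> `|V e x| <= K) ->
  (forall e, Lin e -> box c r e -> V e x0 = 1) ->
  (forall e h j, Lin e -> box c r e -> box c r (fun x => e x + h * V e x) ->
     `|Phi (fun x => e x + h * V e x) j - Phi e j| <= L * h ^+ 2) ->
  forall d, 0 < d -> d * K <= r ->
  exists e, [/\ box c r e, e x0 = c x0 + d
    & forall f, polyfun f ->
      (exists C, forall e s, Lin e -> box c r e ->
         (forall j, `|Phi e j - Phi c j| <= s) -> `|f e| <= C * s) ->
      f e = 0].
Proof.
move=> Linc K0 LinV VK Vx0 PhiV d d0 dKr.
have /choice[u Hu] := fun n =>
  euler_polygon Linc K0 LinV VK Vx0 PhiV n d0 dKr.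
have ubox n x : `|u n x - c x| <= r by have [_ + _ _] := Hu n; exact.
have [l ul] := bounded_cluster_point ubox.
exists l; split.
- move=> x; apply/ler_addgt0Pr => e e0; have [n _ un] := ul e e0 0%N.
  have -> : l x - c x = (u n x - c x) - (u n x - l x) by ring.
  by apply: le_trans (ler_normB _ _) _; rewrite lerD ?ubox ?ltW.
- have p0 : polyfun (fun e : X -> R => e x0 - (c x0 + d)).
    by apply: polyfunB; [exact: polyfun_var | exact: polyfun_const].
  apply/eqP; rewrite -subr_eq0; apply/eqP.
  apply: (polyfun_cluster_eq0 (C := 0) p0 ul) => n.
  by have [_ _ -> _] := Hu n; rewrite subrr normr0 mul0r.
- move=> f pf [C HC].
  apply: (polyfun_cluster_eq0 (C := C * (L * d ^+ 2)) pf ul) => n.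
  by have [Lu bu _ Pu] := Hu n; rewrite -mulrA; exact: HC.
Qed.

(** * Kernel vectors from minors, and the Jacobian as a linear map *)

Section CramerKernel.
Variables (F : fieldType) (a b r : nat) (J : 'M[F]_(a, b)).
Variables (f : 'I_r -> 'I_a) (g : 'I_r -> 'I_b) (j0 : 'I_b).

(** Cramer's solution of the equations [f] in the unknowns [g], with unknown [j0] set to the
    determinant and the remaining ones to 0. Clearing the denominator keeps the entries polynomial
    in [J]. *)
Definition cramer_vec : 'cV[F]_b :=
  \det (mxsub f g J) *: delta_mx j0 0
  - colsub g 1%:M *m (\adj (mxsub f g J) *m col j0 (rowsub f J)).

Lemma cramer_vec_pivot : (forall t, g t != j0) ->
  cramer_vec j0 0 = \det (mxsub f g J).
Proof.
move=> gj0; rewrite !mxE !eqxx mulr1 big1 ?subr0 // => t _.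
by rewrite !mxE eq_sym (negPf (gj0 t)) mul0r.
Qed.

(** By the rank bound the rows selected by [f] span the row space of [J], so a vector killed by them
    is killed by [J]. *)
Lemma cramer_vec_ker : \det (mxsub f g J) != 0 -> (\rank J <= r)%N ->
  J *m cramer_vec = 0.
Proof.
move=> det_neq0 rankJ.
have subE : rowsub f J *m colsub g 1%:M = mxsub f g J.
  by rewrite mulmx_colsub mulmx1 -mxsub_comp.
have ker_rows : rowsub f J *m cramer_vec = 0.
  rewrite mulmxBr mulmxA subE mulmxA mul_mx_adj mul_scalar_mx.
  by rewrite -scalemxAr -colE subrr.
have rank_rows : (r <= \rank (rowsub f J))%N.
  have rk : \rank (mxsub f g J) = r by apply: mxrank_unit; rewrite unitmxE unitfE.
  by rewrite -[X in (X <= _)%N]rk -subE mxrankM_maxl.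
have sub : (rowsub f J <= J)%MS.
  by apply/row_subP => i; rewrite row_rowsub row_sub.
have /submxP[Z ->] : (J <= rowsub f J)%MS.
  rewrite -(geq_leqif (mxrank_leqif_sup sub)).
  exact: leq_trans rankJ rank_rows.
by rewrite -mulmxA ker_rows mulmx0.
Qed.

End CramerKernel.

Section EdgeMatrix.
Variables (F : fieldType) (m : nat) (D B : rel 'I_m).

Definition edge_mx (x : 'cV[F]_#|edges D|) : 'M[F]_m :=
  \matrix_(u, v) \sum_j x j 0 *+ (enum_val j == (u, v)).

Lemma edge_mx_supp x u v : ~~ D u v -> edge_mx x u v = 0.
Proof.
move=> nD; rewrite mxE big1 // => j _; case: eqP => // e.
by have := enum_valP j; rewrite e inE (negPf nD).
Qed.

Lemma edge_mx_enum_val x j :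
  edge_mx x (enum_val j).1 (enum_val j).2 = x j 0.
Proof.
rewrite mxE (bigD1 j) //= -surjective_pairing eqxx big1 ?addr0 // => k /negPf kj.
by rewrite (inj_eq enum_val_inj) kj.
Qed.

Lemma mul_edge_mx (M : 'M_m) x w v :
  (M *m edge_mx x) w v =
  \sum_j M w (enum_val j).1 *+ ((enum_val j).2 == v) * x j 0.
Proof.
rewrite mxE; under eq_bigr do rewrite mxE mulr_sumr.
rewrite exchange_big /=; apply: eq_bigr => j _.
rewrite (bigD1 (enum_val j).1) //= big1 ?addr0 => [|u /negPf uj].
  by rewrite [X in X == _]surjective_pairing xpair_eqE eqxx mulrnAr mulrnAl.
by rewrite [X in X == _]surjective_pairing xpair_eqE eq_sym uj mulr0.
Qed.

(** The coordinates of [jacobian M *m x] are the entries of [M X + (M X)^T] at the pairs in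
    [nonadj], where [X] is the edge matrix of [x]; symmetry supplies the reversed pairs. *)
Lemma jacobian_ker (M : 'M_m) x u v :
  (forall u v, B u v = B v u) -> jacobian D B M *m x = 0 ->
  u != v -> ~~ B u v -> (M *m edge_mx x + (M *m edge_mx x)^T) u v = 0.
Proof.
move=> Bsym Jx; wlog uv : u v / (u < v)%N => [IH | _].
  move=> neq_uv nB; have := neq_uv; rewrite neq_ltn => /orP[uv|vu].
    exact: IH.
  by rewrite !mxE addrC; have := IH _ _ vu; rewrite eq_sym Bsym !mxE; apply.
move=> nB; have uvN : (u, v) \in nonadj B by rewrite inE uv.
have Jx0 : (jacobian D B M *m x) (enum_rank_in uvN (u, v)) 0 = 0.
  by rewrite Jx mxE.
rewrite -{}Jx0 [RHS]mxE [LHS]mxE [(_^T) _ _]mxE !mul_edge_mx addrC -big_split /=.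
apply: eq_bigr => j _; rewrite [in RHS]mxE enum_rankK_in //=.
by rewrite mulrDl.
Qed.

End EdgeMatrix.

(* The Euler step is exact up to second order: [A'^T S A' - O' = h^2 X^T S X]. *)
Lemma congruence_step (F : fieldType) (m : nat) (A A' O O' X : 'M[F]_m) (h : F) :
  A \in unitmx -> A' \in unitmx -> O^T = O ->
  A' = A - h *: X ->
  O' = O - h *: (O *m invmx A *m X + (O *m invmx A *m X)^T) ->
  let S := (invmx A)^T *m O *m invmx A in
  (invmx A')^T *m O' *m invmx A' - S =
  - (h ^+ 2 *: ((invmx A')^T *m (X^T *m S *m X) *m invmx A')).
Proof.
move=> Au A'u Osym eA eO S.
have SA : S *m A = (O *m invmx A)^T.
  by rewrite /S mulmxKV // trmx_mul Osym.
have AS : A^T *m S = O *m invmx A.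
  by rewrite /S !mulmxA -trmx_mul mulVmx // trmx1 mul1mx.
have ASA : A^T *m S *m A = O by rewrite AS mulmxKV.
have key : O' = A'^T *m S *m A' - h ^+ 2 *: (X^T *m S *m X).
  have trA' : (A - h *: X)^T = A^T - h *: X^T by rewrite linearB linearZ.
  have ASX : A^T *m S *m X = O *m invmx A *m X by rewrite AS.
  have XSA : X^T *m S *m A = (O *m invmx A *m X)^T.
    by rewrite -mulmxA SA -trmx_mul.
  rewrite eA eO trA' !(mulmxBl, mulmxBr) -!scalemxAl -!scalemxAr.
  rewrite ASA ASX XSA; move: (_ *m X) (X^T *m S *m X) => P Q.
  by apply/matrixP => i j; rewrite !mxE; ring.
rewrite key mulmxBr mulmxBl.
have -> : (invmx A')^T *m (A'^T *m S *m A') *m invmx A' = S.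
  by rewrite !mulmxA -trmx_mul mulmxV // trmx1 mul1mx mulmxK.
by rewrite addrAC subrr add0r -scalemxAr -scalemxAl.
Qed.

(** * The vector field tangent to the fibers *)

Section Model.
Variables (m : nat) (D B : rel 'I_m).
Implicit Types e : param_var m -> R.

Definition cov_of e : 'M[R]_m := \matrix_(i, j) e (true, (i, j)).
Definition res_of e : 'M[R]_m :=
  \matrix_(i, j) ((i == j)%:R - e (false, (i, j))).

(* The adjugate replaces the inverse so that the entries are polynomials. *)
Definition jac_of e := jacobian D B (cov_of e *m \adj (res_of e)).

Definition sigma_of e : 'M[R]_m :=
  (invmx (res_of e))^T *m cov_of e *m invmx (res_of e).

(** The linear conditions of [Theta] only. Invertibility and positive definiteness are treated
    apart: the first through nonvanishing determinants, the second by congruence. *)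
Definition supported e : Prop :=
  [/\ forall u v, ~~ D u v -> e (false, (u, v)) = 0,
      forall u v, e (true, (u, v)) = e (true, (v, u))
    & forall u v, u != v -> ~~ B u v -> e (true, (u, v)) = 0].

Lemma polyfun_cov : polyfun_mx cov_of.
Proof.
move=> i j; apply: (@eq_polyfun _ (fun e => e (true, (i, j)))) => [e|].
  by rewrite mxE.
exact: polyfun_var.
Qed.

Lemma polyfun_res : polyfun_mx res_of.
Proof.
move=> i j; apply: (@eq_polyfun _ (fun e => (i == j)%:R - e (false, (i, j)))).
  by move=> e; rewrite mxE.
by apply: polyfunB; [exact: polyfun_const | exact: polyfun_var].
Qed.

Lemma polyfun_jac : polyfun_mx jac_of.
Proof.
have pM := polyfun_mxM polyfun_cov (polyfun_adj polyfun_res).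
have pMn (f : (param_var m -> R) -> R) (b : bool) :
    polyfun f -> polyfun (fun e => f e *+ b).
  by case: b => //= _; exact: polyfun_const.
move=> i j; apply: (@eq_polyfun _ (fun e =>
  (cov_of e *m \adj (res_of e)) (enum_val i).2 (enum_val j).1
    *+ ((enum_val j).2 == (enum_val i).1)
  + (cov_of e *m \adj (res_of e)) (enum_val i).1 (enum_val j).1
    *+ ((enum_val j).2 == (enum_val i).2))) => [e|]; first by rewrite [RHS]mxE.
by apply: polyfunD; apply: pMn; exact: pM.
Qed.

Lemma supported_sym e : supported e -> (cov_of e)^T = cov_of e.
Proof. by move=> [_ sym _]; apply/matrixP => i j; rewrite !mxE sym. Qed.

Lemma cov_sigma e : res_of e \in unitmx ->
  (res_of e)^T *m sigma_of e *m res_of e = cov_of e.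
Proof.
by move=> Au; rewrite /sigma_of !mulmxA -trmx_mul mulVmx // trmx1 mul1mx mulmxKV.
Qed.

Lemma invmx_adj n (A : 'M[R]_n) : A \in unitmx ->
  invmx A = (\det A)^-1 *: \adj A.
Proof. by move=> Au; rewrite /invmx Au. Qed.

Section Flow.
Variables (r : nat) (f : 'I_r -> 'I_#|nonadj B|) (g : 'I_r -> 'I_#|edges D|).
Variable j0 : 'I_#|edges D|.

Definition minor_of e : R := \det (mxsub f g (jac_of e)).

Definition flow_mx e : 'M[R]_m :=
  \det (res_of e) *: edge_mx (cramer_vec (jac_of e) f g j0).

(** Moving [Lambda] in a direction [X] forces the motion [-(O A^-1 X + (O A^-1 X)^T)] of [Omega] if
    [sigma_of] is to be constant to first order. This is its numerator over the denominator used in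
    [flow]. *)
Definition flow_cov e : 'M[R]_m :=
  let P := cov_of e *m \adj (res_of e)
             *m edge_mx (cramer_vec (jac_of e) f g j0) in
  - (P + P^T).

Definition flow_num e (x : param_var m) : R :=
  if x.1 then flow_cov e x.2.1 x.2.2 else flow_mx e x.2.1 x.2.2.

Definition flow e (x : param_var m) : R :=
  flow_num e x / (\det (res_of e) * minor_of e).

Lemma polyfun_minor : polyfun minor_of.
Proof.
apply: polyfun_det => i j; apply: eq_polyfun (polyfun_jac (f i) (g j)) => e.
by rewrite [RHS]mxE.
Qed.

Lemma polyfun_cramer : polyfun_mx (fun e => cramer_vec (jac_of e) f g j0).
Proof.
have psub : polyfun_mx (fun e => mxsub f g (jac_of e)).
  move=> i j; apply: eq_polyfun (polyfun_jac (f i) (g j)) => e.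
  by rewrite [RHS]mxE.
have pcol : polyfun_mx (fun e => col j0 (rowsub f (jac_of e))).
  move=> i j; apply: eq_polyfun (polyfun_jac (f i) j0) => e.
  by rewrite [RHS]mxE [RHS]mxE.
have pcst : polyfun_mx (fun _ : param_var m -> R =>
    colsub g (1%:M : 'M[R]_#|edges D|)).
  by move=> i j; exact: polyfun_const.
have pq := polyfun_mxM pcst (polyfun_mxM (polyfun_adj psub) pcol).
move=> i j; apply: (@eq_polyfun _ (fun e =>
  minor_of e * (delta_mx j0 0 : 'cV[R]_#|edges D|) i j
  - (colsub g 1%:M
    *m (\adj (mxsub f g (jac_of e)) *m col j0 (rowsub f (jac_of e)))) i j)).
  by move=> e; rewrite [RHS]mxE [in RHS]mxE [X in _ = _ + X]mxE.
apply: polyfunB; last exact: pq.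
by apply: polyfunM; [exact: polyfun_minor | exact: polyfun_const].
Qed.

Lemma polyfun_edge_mx :
  polyfun_mx (fun e => edge_mx (cramer_vec (jac_of e) f g j0)).
Proof.
move=> u v; apply: (@eq_polyfun _ (fun e => \sum_j
  cramer_vec (jac_of e) f g j0 j 0 * (enum_val j == (u, v))%:R)) => [e|].
  by rewrite [RHS]mxE; apply: eq_bigr => j _; rewrite mulr_natr.
apply: polyfun_sum => j; apply: polyfunM; first exact: polyfun_cramer.
exact: polyfun_const.
Qed.

Lemma polyfun_flow_num x : polyfun (fun e => flow_num e x).
Proof.
case: x => [[] [u v]]; rewrite /flow_num /=.
  have pM := polyfun_mxM (polyfun_mxM polyfun_cov (polyfun_adj polyfun_res))
    polyfun_edge_mx.
  apply: (eq_polyfun _ (polyfunN (polyfunD (pM u v) (pM v u)))) => e.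
  by rewrite [RHS]mxE [in RHS]mxE [in X in _ = - (_ + X)]mxE.
apply: (eq_polyfun _ (polyfunM (polyfun_det polyfun_res) (polyfun_edge_mx u v))).
by move=> e; rewrite [RHS]mxE.
Qed.

Hypothesis Bsym : forall u v, B u v = B v u.

(** The zeros of [Omega] persist because the Cramer vector lies in the kernel of the Jacobian; the
    other conditions follow from the shape of the field. *)
Lemma supported_step e h : supported e ->
  minor_of e != 0 -> (\rank (jac_of e) <= r)%N ->
  supported (fun x => e x + h * flow e x).
Proof.
move=> [sD sS sB] minor_neq0 rankJ.
have Jx := cramer_vec_ker j0 minor_neq0 rankJ.
split=> [u v nD | u v | u v uv nB].
- rewrite sD // /flow /flow_num /flow_mx /= mxE edge_mx_supp //.
  by rewrite mulr0 mul0r mulr0 addr0.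
- rewrite sS; congr (_ + _ * (_ / _)); rewrite /flow_num /flow_cov /=.
  by rewrite [LHS]mxE [RHS]mxE; congr (- _); rewrite !mxE addrC.
- rewrite sB // /flow /flow_num /flow_cov /= [X in h * (X / _)]mxE.
  by rewrite (jacobian_ker Bsym Jx) // oppr0 mul0r mulr0 addr0.
Qed.

Lemma flow_pivot e : (forall t, g t != j0) ->
  \det (res_of e) * minor_of e != 0 -> flow e (false, enum_val j0) = 1.
Proof.
move=> gj0 den_neq0; rewrite /flow /flow_num /flow_mx /= mxE.
by rewrite edge_mx_enum_val cramer_vec_pivot // divff.
Qed.

Lemma sigma_step e h : let e' := (fun x => e x + h * flow e x) in
  supported e -> res_of e \in unitmx -> res_of e' \in unitmx ->
  minor_of e != 0 ->
  let X := \matrix_(u, v) flow e (false, (u, v)) in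
  sigma_of e' - sigma_of e =
  - (h ^+ 2 *: ((invmx (res_of e'))^T *m (X^T *m sigma_of e *m X)
       *m invmx (res_of e'))).
Proof.
move=> e' se Au A'u minor_neq0 X.
apply: congruence_step => //; first exact: supported_sym.
  by apply/matrixP => u v; rewrite !mxE /e'; ring.
have detA : \det (res_of e) != 0 by rewrite -unitfE -unitmxE.
have -> : cov_of e *m invmx (res_of e) *m X = (\det (res_of e) * minor_of e)^-1 *:
   (cov_of e *m \adj (res_of e) *m edge_mx (cramer_vec (jac_of e) f g j0)).
  have -> : X = (minor_of e)^-1 *: edge_mx (cramer_vec (jac_of e) f g j0).
    apply/matrixP => u v; rewrite [LHS]mxE [RHS]mxE /flow /flow_num /=.
    rewrite /flow_mx [X in X / _]mxE; field.
    by rewrite detA minor_neq0.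
  by rewrite invmx_adj // -!scalemxAr -!scalemxAl scalerA invfM mulrC.
apply/matrixP => u v; rewrite mxE /e' /flow /flow_num /flow_cov /=.
move: (_ *m _ *m _) (_ * minor_of _) => P w; by rewrite !mxE; ring.
Qed.

Hypothesis rank_jac : forall e, supported e -> res_of e \in unitmx ->
  (\rank (jac_of e) <= r)%N.
Hypothesis gj0 : forall t, g t != j0.

(** On a small box the denominator of the field is bounded away from 0, so [euler_limit] applies
    with [supported] as [Lin] and the entries of [sigma_of] as [Phi]. *)
Lemma fiber_curve c : supported c -> res_of c \in unitmx -> minor_of c != 0 ->
  exists2 d0, 0 < d0 & forall d, 0 < d <= d0 ->
    exists e, [/\ supported e, res_of e \in unitmx, sigma_of e = sigma_of c
      & e (false, enum_val j0) = c (false, enum_val j0) + d].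
Proof.
move=> sc Ac minor_c.
have pden : polyfun (fun e => \det (res_of e) * minor_of e).
  exact: polyfunM (polyfun_det polyfun_res) polyfun_minor.
have den_c : \det (res_of c) * minor_of c != 0.
  by rewrite mulf_neq0 // -unitfE -unitmxE.
have [rho [delta [/andP[rho0 rho1] delta0 Hden]]] := polyfun_neq0_near pden den_c.
pose Q e := supported e /\ box c rho e.
have r01 : 0 <= rho <= 1 by rewrite ltW.
have den_neq0 e : box c rho e -> \det (res_of e) * minor_of e != 0.
  by move=> be; rewrite -normr_gt0 (lt_le_trans delta0) // Hden.
have Qunit e : box c rho e -> res_of e \in unitmx /\ minor_of e != 0.
  move=> be; have := den_neq0 e be; rewrite mulf_eq0 negb_or => /andP[dA ->].
  by rewrite unitmxE unitfE.
have bpoly f' : polyfun f' -> bounded_on Q f'.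
  move=> pf; have [K HK] := polyfun_bounded c r01 pf.
  by exists K => e [_ be]; exact: HK.
have bden : bounded_on Q (fun e => (\det (res_of e) * minor_of e)^-1).
  exists delta^-1 => e [_ be]; rewrite normfV lef_pV2 ?posrE ?Hden //.
  exact: lt_le_trans delta0 (Hden e be).
have bflow x : bounded_on Q (fun e => flow e x).
  by apply: bounded_onM bden; apply: bpoly; exact: polyfun_flow_num.
have binv u v : bounded_on Q (fun e => invmx (res_of e) u v).
  have [K HK] := bounded_onM
    (bounded_onM bden (bpoly _ polyfun_minor))
    (bpoly _ (polyfun_adj polyfun_res u v)).
  exists K => e [se be]; have [Au minor_neq0] := Qunit e be.
  have -> : invmx (res_of e) u v =
      (\det (res_of e) * minor_of e)^-1 * minor_of e * \adj (res_of e) u v.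
    by rewrite invmx_adj // mxE invfM mulfVK.
  exact: HK.
have bsigma u v : bounded_on Q (fun e => sigma_of e u v).
  apply: bounded_on_mxM; last exact: binv.
  apply: bounded_on_mxM => i j; last exact: bpoly (polyfun_cov i j).
  by have [K HK] := binv j i; exists K => e Qe; rewrite mxE HK.
have [K K0 HK] := bounded_on_uniform bflow.
pose Phi e (ij : 'I_m * 'I_m) := sigma_of e ij.1 ij.2.
pose Xmx e : 'M[R]_m := \matrix_(u, v) flow e (false, (u, v)).
(* The second-order defect involves the inverse at the new point and the field at the old one, hence
   pairs of points. *)
pose QQ (t : (param_var m -> R) * (param_var m -> R)) := Q t.1 /\ Q t.2.
have [L L0 HL] : exists2 L, 0 <= L & forall (ij : 'I_m * 'I_m)
      (t : (param_var m -> R) * (param_var m -> R)), QQ t ->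
    `|((invmx (res_of t.2))^T
        *m ((Xmx t.1)^T *m sigma_of t.1 *m Xmx t.1)
        *m invmx (res_of t.2)) ij.1 ij.2| <= L.
  apply: bounded_on_uniform => -[i j] /=.
  have binv2 u v : bounded_on QQ (fun t => invmx (res_of t.2) u v).
    by have [K' HK'] := binv u v; exists K' => t [_ Qt]; exact: HK'.
  have bX u v : bounded_on QQ (fun t => Xmx t.1 u v).
    have [K' HK'] := bflow (false, (u, v)).
    by exists K' => t [Qt _]; rewrite mxE; exact: HK'.
  apply: bounded_on_mxM; last exact: binv2.
  apply: bounded_on_mxM.
    move=> u v; have [K' HK'] := binv2 v u.
    by exists K' => t Qt; rewrite mxE; exact: HK'.
  apply: bounded_on_mxM; last exact: bX.
  apply: bounded_on_mxM.
    move=> u v; have [K' HK'] := bX v u.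
    by exists K' => t Qt; rewrite mxE; exact: HK'.
  move=> u v; have [K' HK'] := bsigma u v.
  by exists K' => t [Qt _]; exact: HK'.
have limit := @euler_limit _ ('I_m * 'I_m)%type (false, enum_val j0) c rho K L
  supported flow Phi sc K0.
exists (rho / (K + 1)) => [|d /andP[d0 dle]]; first by rewrite divr_gt0 //; lra.
have dK : d * K <= rho.
  have : d * (K + 1) <= rho by rewrite -ler_pdivlMr //; lra.
  by rewrite mulrDr mulr1; lra.
have [| | | |e [be ex0 He]] := limit _ _ _ _ d d0 dK.
- move=> e h se be; have [Au minor_neq0] := Qunit e be.
  by apply: supported_step => //; exact: rank_jac.
- by move=> e x se be; exact: HK.
- by move=> e se be; apply: flow_pivot gj0 (den_neq0 _ be).
- move=> e h ij se be be'; have [Au minor_neq0] := Qunit e be.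
  have [A'u _] := Qunit _ be'.
  have se' := supported_step h se minor_neq0 (rank_jac se Au).
  have := sigma_step se Au A'u minor_neq0; rewrite /Phi.
  move=> /matrixP/(_ ij.1 ij.2); rewrite [LHS]mxE [X in _ + X = _]mxE => ->.
  rewrite mxE normrN mxE normrM ger0_norm ?sqr_ge0 // mulrC.
  by rewrite ler_wpM2r ?sqr_ge0 // (HL ij (e, _)).
have se : supported e.
  (* A polynomial that vanishes on all supported points satisfies the control condition with
     constant 0. *)
  have vanish f' : polyfun f' ->
      (forall e', supported e' -> f' e' = 0) -> f' e = 0.
    move=> pf Hf; apply: He => //; exists 0 => e' s se' _ _.
    by rewrite Hf // normr0 mul0r.
  split=> [u v nD | u v | u v uv nB].
  - by apply: (vanish (fun e => e _)) => [|e' [sD _ _]];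
      [exact: polyfun_var | exact: sD].
  - apply/eqP; rewrite -subr_eq0; apply/eqP.
    apply: (vanish (fun e => e _ - e _)) => [|e' [_ sS _]].
      by apply: polyfunB; exact: polyfun_var.
    by rewrite sS subrr.
  - by apply: (vanish (fun e => e _)) => [|e' [_ _ sB]];
      [exact: polyfun_var | exact: sB].
have [Au _] := Qunit e be.
(* Equality of the covariances is rewritten without inverses, which makes it a polynomial identity
   that passes to the limit. *)
have cov_e : (res_of e)^T *m sigma_of c *m res_of e - cov_of e = 0.
  apply/matrixP => i j; rewrite [RHS]mxE.
  have pc : polyfun_mx (fun _ : param_var m -> R => sigma_of c).
    by move=> u v; exact: polyfun_const.
  have pT : polyfun_mx (fun e => (res_of e)^T).
    by move=> u v; apply: eq_polyfun (polyfun_res v u) => e'; rewrite [RHS]mxE.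
  have pF := polyfun_mxM (polyfun_mxM pT pc) polyfun_res.
  apply: (He (fun e => ((res_of e)^T *m sigma_of c *m res_of e - cov_of e) i j)).
    apply: eq_polyfun (polyfunB (pF i j) (polyfun_cov i j)) => e'.
    by rewrite [RHS]mxE [X in _ = _ + X]mxE.
  have [Ka Ka0 HKa] := bounded_on_uniform
    (fun uv : 'I_m * 'I_m => bpoly _ (polyfun_res uv.1 uv.2)).
  exists (\sum_(k < m) \sum_(l < m) Ka * Ka) => e' s se' be' Hs.
  have [A'u _] := Qunit e' be'.
  have -> : (res_of e')^T *m sigma_of c *m res_of e' - cov_of e' =
      (res_of e')^T *m (sigma_of c - sigma_of e') *m res_of e'.
    by rewrite mulmxBr mulmxBl cov_sigma.
  rewrite mxE mulr_suml; apply: le_trans (ler_norm_sum _ _ _) _.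
  apply: ler_sum => l _; rewrite mxE !mulr_suml.
  apply: le_trans (ler_norm_sum _ _ _) _.
  apply: ler_sum => k _; rewrite mulrAC !normrM [(_^T) i k]mxE.
  rewrite ler_pM ?mulr_ge0 //.
    by rewrite ler_pM // (HKa (_, _)).
  by rewrite mxE [X in `|_ + X|]mxE distrC; exact: (Hs (k, l)).
exists e; split=> //.
move/eqP: cov_e; rewrite subr_eq0 => /eqP cov_e.
rewrite {1}/sigma_of -cov_e !mulmxA -trmx_mul mulmxV // trmx1 mul1mx.
by rewrite mulmxK.
Qed.

End Flow.
End Model.

(** * Genericity *)

Lemma rank_jac_lt (m : nat) (D B : rel 'I_m) (e : param_var m -> R) :
  mixed_graph D B ->
  (forall Y : 'I_m -> {set 'I_m},
     (exists v, ~ HTC D B (Y v) v) \/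
     (exists v w, v != w /\ v \in Y w /\ w \in Y v)) ->
  supported D B e -> res_of e \in unitmx ->
  (\rank (jac_of D B e) < #|edges D|)%N.
Proof.
move=> mg noY [sD sS sB] Au; rewrite ltn_neqAle rank_leq_col andbT.
apply/negP => Jfull.
have detA : \det (res_of e) != 0 by rewrite -unitfE -unitmxE.
(* The factor [\det (res_of e)] turns the inverse in [full_rank_HTC] into the adjugate of [jac_of]
   and leaves the support of [Omega] unchanged. *)
have [||||Y [htY noconf]] :=
  @full_rank_HTC _ m D B (\det (res_of e) *: cov_of e) (res_of e) mg.
- move=> i j; rewrite mxE; have [-> _ | _] := eqVneq i j; first by left.
  rewrite sub0r oppr_eq0 => e_neq0; right.
  by apply: contraNT e_neq0 => nD; rewrite sD.
- move=> i j; rewrite !mxE mulf_eq0 negb_or => /andP[_ e_neq0].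
  have [-> | ij] := eqVneq i j; [by left | right].
  by apply: contraNT e_neq0 => nB; rewrite sB.
- exact: Au.
- rewrite -scalemxAl invmx_adj // -scalemxAr scalerA divff // scale1r.
  exact: Jfull.
- by case: (noY Y) => [[v []]|//]; exact: htY.
Qed.

Lemma supported0 (m : nat) (D B : rel 'I_m) :
  supported D B (fun _ => 0) /\ res_of (fun _ : param_var m => 0) \in unitmx.
Proof.
split=> //; have -> : res_of (fun=> 0) = 1%:M :> 'M[R]_m; last exact: unitmx1.
by apply/matrixP => i j; rewrite !mxE subr0.
Qed.

(** The maximum ranges over all supported points with invertible [res_of], so that the rank bound
    holds along Euler polygons, which may leave the positive definite cone. *)
Lemma max_rank_jac (m : nat) (D B : rel 'I_m) : exists e1,
  [/\ supported D B e1, res_of e1 \in unitmx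
    & forall e, supported D B e -> res_of e \in unitmx ->
      (\rank (jac_of D B e) <= \rank (jac_of D B e1))%N].
Proof.
pose P k := `[< exists e, [/\ supported D B e, res_of e \in unitmx
  & \rank (jac_of D B e) = k] >].
have exP : exists k, P k.
  by have [s0 u0] := supported0 D B; eexists; apply/asboolP; exists (fun=> 0).
have ubP k : P k -> (k <= #|edges D|)%N.
  by move/asboolP => [e [_ _ <-]]; exact: rank_leq_col.
case: (ex_maxnP exP ubP) => k /asboolP[e1 [se1 u1 <-]] kmax.
by exists e1; split=> // e se ue; apply: kmax; apply/asboolP; exists e.
Qed.

Lemma unit_minor (F : fieldType) (a b : nat) (J : 'M[F]_(a, b)) :
  exists (f : 'I_(\rank J) -> 'I_a) (g : 'I_(\rank J) -> 'I_b),
    \det (mxsub f g J) != 0.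
Proof.
have free := maxrowsub_free J; set f := maxrankfun J in free.
have full : row_full (rowsub f J)^T by rewrite /row_full mxrank_tr.
exists f, (fullrankfun full).
have := fullrowsub_unit full.
by rewrite unitmxE unitfE -det_tr; congr (\det _ != 0);
  apply/matrixP => i j; rewrite !mxE.
Qed.

(** * Positive definiteness and generic shifts *)

Definition posdef (m : nat) (O : 'M[R]_m) : Prop :=
  forall x : 'cV[R]_m, x != 0 -> 0 < (x^T *m O *m x) 0 0.

Lemma posdef_congr (m : nat) (O Z : 'M[R]_m) :
  Z \in unitmx -> posdef O -> posdef (Z^T *m O *m Z).
Proof.
move=> Zu pO x x0; have := pO (Z *m x).
rewrite trmx_mul !mulmxA; apply; apply: contraNneq x0 => Zx0.
by rewrite -[x](mulKmx Zu) Zx0 mulmx0.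
Qed.

Lemma quad_sum (m : nat) (O : 'M[R]_m) (x : 'cV[R]_m) :
  (x^T *m O *m x) 0 0 = \sum_i \sum_j x i 0 * O i j * x j 0.
Proof.
rewrite mxE exchange_big /=; apply: eq_bigr => j _.
by rewrite mxE mulr_suml; apply: eq_bigr => i _; rewrite mxE.
Qed.

(** Each product of two coordinates of [x] is at most the squared norm [q] in absolute value, so the
    form of [O] is at least [- q] times the sum of the absolute entries. *)
Lemma posdef_shift (m : nat) (O : 'M[R]_m) (t : R) :
  \sum_i \sum_j `|O i j| < t -> posdef (O + t%:M).
Proof.
move=> Ot x x0; rewrite quad_sum.
pose q := \sum_k x k 0 ^+ 2.
have q_ge k : x k 0 ^+ 2 <= q.
  by rewrite /q (bigD1 k) //= lerDl sumr_ge0 // => *; exact: sqr_ge0.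
have q0 : 0 < q.
  have [k xk] : exists k, x k 0 != 0.
    apply/existsP; apply: contraNT x0 => /existsPn H.
    by apply/eqP/colP => k; rewrite mxE; apply/eqP; rewrite -[_ == _]negbK H.
  by apply: lt_le_trans (q_ge k); rewrite exprn_even_gt0.
have -> : \sum_i \sum_j x i 0 * (O + t%:M) i j * x j 0 =
    \sum_i \sum_j x i 0 * O i j * x j 0 + t * q.
  rewrite /q mulr_sumr -big_split; apply: eq_bigr => i _ /=.
  have -> : t * x i 0 ^+ 2 = \sum_j (if j == i then t * x i 0 ^+ 2 else 0).
    by rewrite -big_mkcond big_pred1_eq.
  rewrite -big_split; apply: eq_bigr => j _ /=; rewrite !mxE eq_sym.
  by case: eqP => [->|_]; rewrite ?mulr1n ?mulr0n; ring.
have : - \sum_i \sum_j x i 0 * O i j * x j 0 <= (\sum_i \sum_j `|O i j|) * q.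
  rewrite -sumrN mulr_suml; apply: ler_sum => i _.
  rewrite -sumrN mulr_suml; apply: ler_sum => j _.
  apply: le_trans (ler_norm _) _; rewrite normrN !normrM.
  have := q_ge i; have := q_ge j; have := sqr_ge0 (`|x i 0| - `|x j 0|).
  rewrite -(real_normK (num_real (x i 0))) -(real_normK (num_real (x j 0))).
  have := normr_ge0 (O i j).
  move: `|O i j| `|x i 0| `|x j 0| => a u v a0 uv vq uq.
  have -> : u * a * v = a * (u * v) by ring.
  by apply: ler_wpM2l => //; nra.
move: Ot q0; set s := \sum_i _; set z := \sum_i _ => st q0; nra.
Qed.

(** The determinant is a polynomial in [t] that is nonzero at 0, so among [size q] distinct values
    above [b] one is not a root. *)
Lemma det_shift_neq0 (n : nat) (P W : 'M[R]_n) (b : R) :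
  \det P != 0 -> exists2 t, b < t & \det (P + t *: W) != 0.
Proof.
move=> detP; pose q := \det (map_mx polyC P + 'X *: map_mx polyC W).
have qE t : q.[t] = \det (P + t *: W).
  rewrite -horner_evalE -det_map_mx; congr (\det _).
  by apply/matrixP => i j; rewrite !mxE /= horner_evalE !hornerE.
have q0 : q != 0.
  by apply: contraNneq detP => q0; rewrite -[P]addr0 -(scale0r W) -qE q0 horner0.
pose ts := [seq b + 1 + k%:R | k <- iota 0 (size q)].
have uts : uniq ts.
  rewrite map_inj_uniq ?iota_uniq // => i j /addrI /eqP.
  by rewrite eqr_nat => /eqP.
have /allPn[t] : ~~ all (root q) ts.
  apply/negP => /(max_poly_roots q0)/(_ uts).
  by rewrite size_map size_iota ltnn.
move=> /mapP[k _ ->] nroot; exists (b + 1 + k%:R); last by rewrite -qE.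
by have := ler0n R k; lra.
Qed.

(** * Dictionary between function matrices and ['M[R]_m] *)

Definition mat (m : nat) (A : mx m) : 'M[R]_m := \matrix_(i, j) A i j.

Lemma mat_inj (m : nat) : injective (@mat m).
Proof.
move=> A C /matrixP AC; apply/funext => i; apply/funext => j.
by have := AC i j; rewrite !mxE.
Qed.

Lemma mat_mul (m : nat) (A C : mx m) : mat (mx_mul A C) = mat A *m mat C.
Proof.
by apply/matrixP => i j; rewrite !mxE; apply: eq_bigr => k _; rewrite !mxE.
Qed.

Lemma mat_id (m : nat) : mat (mx_id m) = 1%:M.
Proof. by apply/matrixP => i j; rewrite !mxE /mx_id; case: eqP. Qed.

Lemma mat_tr (m : nat) (A : mx m) : mat (mx_tr A) = (mat A)^T.
Proof. by apply/matrixP => i j; rewrite !mxE. Qed.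

Lemma mat_fun (m : nat) (A : 'M[R]_m) : mat (fun i j => A i j) = A.
Proof. by apply/matrixP => i j; rewrite mxE. Qed.

Lemma is_inverseP (m : nat) (A N : mx m) :
  is_inverse A N <-> mat A \in unitmx /\ mat N = invmx (mat A).
Proof.
split=> [[AN NA]|[Au eN]].
  have AN1 : mat A *m mat N = 1%:M by rewrite -mat_mul AN mat_id.
  have [Au _] := mulmx1_unit AN1; split=> //.
  by rewrite -[RHS]mulmx1 -AN1 mulKmx.
by split; apply: mat_inj; rewrite mat_mul mat_id eN ?mulmxV ?mulVmx.
Qed.

Section Encoding.
Variables (m : nat) (D B : rel 'I_m).

Lemma mat_res (p : mx m * mx m) :
  mat (mx_sub (mx_id m) p.1) = res_of (param_env p).
Proof. by apply/matrixP => i j; rewrite !mxE /mx_sub /mx_id /=; case: eqP. Qed.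

Lemma mat_cov (p : mx m * mx m) : mat p.2 = cov_of (param_env p).
Proof. by apply/matrixP => i j; rewrite !mxE. Qed.

Lemma invertibleP (p : mx m * mx m) :
  invertible (mx_sub (mx_id m) p.1) <-> res_of (param_env p) \in unitmx.
Proof.
rewrite -mat_res; split=> [[N /is_inverseP[]] // | Au].
by exists (fun i j => invmx (mat (mx_sub (mx_id m) p.1)) i j);
  apply/is_inverseP; rewrite mat_fun.
Qed.

Lemma phi_relP (p : mx m * mx m) (S : mx m) :
  phi_rel p S <->
  res_of (param_env p) \in unitmx /\ mat S = sigma_of (param_env p).
Proof.
split=> [[N [/is_inverseP[Au eN] ->]] | [Au eS]].
  rewrite mat_res in Au eN.
  by rewrite !mat_mul mat_tr eN mat_cov mulmxA.
exists (fun i j => invmx (res_of (param_env p)) i j); split.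
  by apply/is_inverseP; rewrite mat_res mat_fun.
by apply: mat_inj; rewrite eS !mat_mul mat_tr mat_fun mat_cov mulmxA.
Qed.

Lemma ThetaP (p : mx m * mx m) :
  Theta D B p <-> [/\ supported D B (param_env p),
    res_of (param_env p) \in unitmx & posdef (cov_of (param_env p))].
Proof.
have quadE (x : 'cV[R]_m) : (x^T *m cov_of (param_env p) *m x) 0 0 =
   \big[Rplus/R0]_(i < m) \big[Rplus/R0]_(j < m)
     Rmult (Rmult (x i 0) (p.2 i j)) (x j 0).
  rewrite quad_sum; apply: eq_bigr => i _; apply: eq_bigr => j _.
  by rewrite mxE.
split=> [[[LD /invertibleP Au] [Osym [OB Opd]]] | [[sD sS sB] Au pd]].
  split=> //; move=> x x0; rewrite quadE; apply/RltP.
  apply: (Opd (fun i => x i 0)).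
  apply: contrapT => H; case/eqP: x0; apply/colP => i; rewrite mxE.
  by apply: contrapT => xi; apply: H; exists i.
split; first by split=> //; apply/invertibleP.
split; [exact: sS | split; first exact: sB] => x [i xi].
pose y : 'cV[R]_m := \col_k x k.
have y0 : y != 0.
  by apply/eqP => /matrixP/(_ i 0); rewrite !mxE; exact: xi.
have := pd y y0; rewrite quadE => /RltP; congr (Rlt _ _).
by apply: eq_bigr => k _; apply: eq_bigr => l _; rewrite !mxE.
Qed.

Definition param_of (e : param_var m -> R) : mx m * mx m :=
  (fun i j => e (false, (i, j)), fun i j => e (true, (i, j))).

Lemma param_ofK e : param_env (param_of e) = e.
Proof. by apply/funext => -[[] [i j]]. Qed.

End Encoding.

Lemma jacobianD (F : fieldType) (m : nat) (D B : rel 'I_m) (M N : 'M[F]_m) :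
  jacobian D B (M + N) = jacobian D B M + jacobian D B N.
Proof. by apply/matrixP => i j; rewrite !mxE !mulrnDl addrACA. Qed.

Lemma jacobianZ (F : fieldType) (m : nat) (D B : rel 'I_m) (a : F) (M : 'M[F]_m) :
  jacobian D B (a *: M) = a *: jacobian D B M.
Proof. by apply/matrixP => i j; rewrite !mxE mulrDr !mulrnAr. Qed.

(* Shifting the covariance by [t I] for large [t] reaches the positive definite
   cone, and the minor is a polynomial in [t] that does not vanish at 0. *)
Lemma minor_posdef (m : nat) (D B : rel 'I_m) (r : nat)
    (f : 'I_r -> 'I_#|nonadj B|) (g : 'I_r -> 'I_#|edges D|)
    (e1 : param_var m -> R) :
  supported D B e1 -> minor_of f g e1 != 0 ->
  exists e, [/\ supported D B e, res_of e = res_of e1, posdef (cov_of e)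
    & minor_of f g e != 0].
Proof.
move=> [sD sS sB] minor1.
(* The shift leaves [res_of] fixed and adds [t] times its adjugate to the argument of the linear map
   [jacobian]. *)
have [t bt det_t] := det_shift_neq0 (mxsub f g (jacobian D B (\adj (res_of e1))))
  (\sum_i \sum_j `|cov_of e1 i j|) minor1.
exists (fun x => e1 x + (if x.1 then t *+ (x.2.1 == x.2.2) else 0)).
set e := (fun x => _).
have res_e : res_of e = res_of e1 by apply/matrixP => i j; rewrite !mxE /e /= addr0.
have cov_e : cov_of e = cov_of e1 + t%:M by apply/matrixP => i j; rewrite !mxE.
split=> //; first split=> [u v nD | u v | u v uv nB].
- by rewrite /e /= sD // addr0.
- by rewrite /e /= sS eq_sym.
- by rewrite /e /= sB // (negPf uv) addr0.
- by rewrite cov_e; exact: posdef_shift.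
rewrite /minor_of /jac_of res_e cov_e mulmxDl mul_scalar_mx jacobianD jacobianZ.
by congr (\det _ != 0): det_t; apply/matrixP => i j; rewrite !mxE.
Qed.

(** Finitely many values of [h] leave a gap just above [a]; [d] is shrunk below each value in
    turn. *)
Lemma avoid_list (T : Type) (h : T -> R) (a d0 : R) (l : list T) : 0 < d0 ->
  exists2 d, 0 < d <= d0 & forall q, List.In q l -> h q != a + d.
Proof.
move=> d0_gt0; suff [d d_le Hd] : exists2 d, 0 < d <= d0 &
    forall q, List.In q l -> h q <= a \/ a + d < h q.
  exists d => // q /Hd[|]; last by move/gt_eqF->.
  by move=> hq; rewrite lt_eqF // (le_lt_trans hq) // ltrDl; case/andP: d_le.
elim: l => [|q l [d /andP[d_gt0 d_le] Hd]]; first by exists d0; rewrite ?d0_gt0 /=.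
have [hq | hq] := leP (h q) a.
  by exists d; rewrite ?d_gt0 // => q' /= [<-|/Hd //]; left.
pose d' := Num.min d ((h q - a) / 2).
have d'_gt0 : 0 < d' by rewrite lt_min d_gt0 divr_gt0 // subr_gt0.
have d'_le : d' <= d by rewrite ge_min lexx.
have d'_hq : d' <= (h q - a) / 2 by rewrite ge_min lexx orbT.
exists d'; rewrite ?d'_gt0 ?(le_trans d'_le) // => q' /= [<-|/Hd[|H]].
- by right; lra.
- by left.
- by right; lra.
Qed.

Theorem mainTheorem2 (m : nat) (D B : rel 'I_m) :
  mixed_graph D B ->
  (forall Y : 'I_m -> {set 'I_m},
     (exists v, ~ HTC D B (Y v) v) \/
     (exists v w, v != w /\ v \in Y w /\ w \in Y v)) ->
  generically_infinite_to_one D B.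
Proof.
move=> mg noY; have [_ [_ Bsym]] := mg.
have [e1 [se1 u1 maxr]] := max_rank_jac D B.
have := rank_jac_lt mg noY se1 u1.
have [f [g minor1]] := unit_minor (jac_of D B e1).
move: (\rank _) f g minor1 maxr => r f g minor1 maxr r_lt.
(* The rank is smaller than the number of edges, so some edge lies outside the columns of the minor;
   its coefficient will parametrize points of the fiber. *)
have [j0 gj0] : exists j0, forall t, g t != j0.
  have /subsetPn[j0 _ j0g] : ~~ ([set: 'I_#|edges D|] \subset codom g).
    apply: contraL r_lt => /subset_leq_card; rewrite cardsT card_ord -leqNgt.
    by move/leq_trans; apply; rewrite -[leqRHS]card_ord; exact: leq_image_card.
  by exists j0 => t; apply: contraNneq j0g => <-; exact: codom_f.
have [p pE] := polyfun_minor f g.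
exists (fun q => Theta D B q /\ minor_of f g (param_env q) = 0); split.
  split; first exists [:: p] => q.
    split=> [[Tq m0]|[Tq pq]]; split=> //; first by move=> _ [<-|//]; rewrite pE.
    by rewrite -pE; apply: pq; left.
  have [e [se res_e pd me]] := minor_posdef se1 minor1.
  exists (param_of e); split; last by rewrite param_ofK => -[_ /eqP]; apply/negP.
  by apply/ThetaP; rewrite param_ofK res_e.
move=> q /[dup] Tq /ThetaP[sq uq pdq] nAq l.
have mq : minor_of f g (param_env q) != 0.
  by apply/eqP => mq; apply: nAq.
have [d0 d0_gt0 Hd0] := fiber_curve Bsym maxr gj0 sq uq mq.
pose h (q' : mx m * mx m) := q'.1 (enum_val j0).1 (enum_val j0).2.
have [d d_le Hd] := avoid_list h (h q) l d0_gt0.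
have [e [se ue sig_e ej0]] := Hd0 d d_le.
exists (param_of e); split; last first.
  move=> /Hd /eqP; apply; move: ej0; rewrite /param_env /=.
  by rewrite /h /= -surjective_pairing.
split.
  apply/ThetaP; rewrite param_ofK; split=> //.
  (* Equal covariances make the two matrices [Omega] congruent through [Z], which carries positive
     definiteness to the new point. *)
  pose Z := invmx (res_of (param_env q)) *m res_of e.
  have -> : cov_of e = Z^T *m cov_of (param_env q) *m Z.
    by rewrite -(cov_sigma ue) sig_e /sigma_of trmx_mul !mulmxA.
  by apply: posdef_congr; rewrite // unitmx_mul unitmx_inv uq.
exists (fun i j => sigma_of (param_env q) i j).
by split; apply/phi_relP; rewrite mat_fun ?param_ofK ?sig_e.
Qed.
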